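(* Let $x_1,x_2,\ldots$ be iid observations distributed according to a one-dimensional exponential family with density $p_\theta(x)=\exp(\eta(\theta)T(x)-A(\eta(\theta))-B(x))$ with respect to $\nu$ (satisfying the assumptions listed in the context), and let $\theta$ be distributed according to a prior having a continuous strictly positive density $\pi$ on a convex set $\Theta\subseteq\mathbb{R}$. When $\theta_0,\theta_1\in\Theta$ and $\theta_1\neq\theta_0$, the sequence $\mathbb{E}_{\theta_1}[q_n^{\theta_0}]$ is eventually strictly decreasing in $n$ (i.e., strictly decreasing from some $n$ on).
   Context: Setting. $\mathcal{X}\subseteq\mathbb{R}$ is the space of observations and $\nu$ is a $\sigma$-finite measure on the Borel sets of $\mathcal{X}$ (e.g. counting measure or Lebesgue measure). The parameter space $\Theta\subseteq\mathbb{R}$ is a convex set, and the prior on $\Theta$ is a probability measure with density $\pi$ with respect to Lebesgue measure, continuous and strictly positive on $\Theta$. For each $\theta\in\Theta$ the conditional probability $\mathbb{P}_\theta$ on $\mathcal{X}$ has density $p_\theta(x)=\exp(\eta(\theta)T(x)-A(\eta(\theta))-B(x))$ with respect to $\nu$, for some functions $\eta,T,A,B$, where $\eta$ is differentiable and $\eta'(\theta)>0$ for all $\theta\in\Theta$. (It is well known that $A$ is determined by $B$ and $T$, is infinitely differentiable, and that $A'(\eta(\theta))=\mathbb{E}_\theta[T(x)]$ and $A''(\eta(\theta))=\mathrm{Var}_\theta(T(x))$.) It is assumed that $A''(\eta(\theta))>0$ (that is, $T(x)$ is not $\mathbb{P}_\theta$-a.s. constant) for all $\theta\in\Theta$. For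 $s_n=(x_1,\ldots,x_n)$ put $p_\theta(s_n)=\prod_{i=1}^n p_\theta(x_i)$ and $p(s_n)=\int_\Theta p_\theta(s_n)\pi(\theta)\,\mathrm{d}\theta$. The posterior density at $\theta_0$ is $q_n^{\theta_0}(s_n)=p_{\theta_0}(s_n)\pi(\theta_0)/p(s_n)$, and $\mathbb{E}_{\theta_1}$ denotes expectation when $x_1,x_2,\ldots$ are iid with density $p_{\theta_1}$, so $$\mathbb{E}_{\theta_1}[q_n^{\theta_0}]=\int_{\mathcal{X}^n}\frac{p_{\theta_0}(s_n)\pi(\theta_0)}{p(s_n)}\,p_{\theta_1}(s_n)\,\mathrm{d}\nu^n(s_n).$$ *)

(* Defs.v *)
From HB Require Import structures.
From mathcomp Require Import all_boot all_order all_algebra.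
From mathcomp Require Import all_classical all_reals all_analysis.

Set Implicit Arguments.
Unset Strict Implicit.
Unset Printing Implicit Defensive.

Import Order.TTheory GRing.Theory Num.Theory.
Import numFieldNormedType.Exports.

Local Open Scope classical_set_scope.
Local Open Scope ring_scope.

Section BorelSubspace.
Variable R : realType.

(* The subset X as a type, with the trace on X of the Borel sets of R; X need
   not itself be Borel.  The proof that X is nonempty is there only because
   measurable types are pointed. *)
Definition borel_subspace (X : set R) (X0 : X !=set0) : Type := {x : R | x \in X}.

Variables (X : set R) (X0 : X !=set0).
Local Notation XT := (borel_subspace X0).

Definition borel_subspace_point : XT :=
  exist _ (sval (cid X0)) (mem_set (svalP (cid X0))).

HB.instance Definition _ := Choice.copy XT {x : R | x \in X}.
HB.instance Definition _ := isPointed.Build XT borel_subspace_point.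

Definition borel_subspace_inj : XT -> measurableTypeR R := fun x => sval x.

HB.instance Definition _ := Measurable.copy XT
  (g_sigma_algebra_preimageType borel_subspace_inj).

End BorelSubspace.

(* The library's sigma-finite structure on a product measure is shadowed by the
   subprobability one and is not found by canonical structure inference. *)
Lemma product_sigma_finite d1 d2 (T1 : measurableType d1)
    (T2 : measurableType d2) (R : realType)
    (m1 : {sigma_finite_measure set T1 -> \bar R})
    (m2 : {sigma_finite_measure set T2 -> \bar R}) :
  sigma_finite setT (m1 \x m2)%E.
Proof.
have /sigma_finiteP[F [TF ndF Foo]] := sigma_finiteT m1.
have /sigma_finiteP[G [TG ndG Goo]] := sigma_finiteT m2.
exists (fun n => F n `*` G n).
  rewrite -setXTT TF TG predeqE => -[x y]; split.
    move=> [/= [n _ Fnx] [k _ Gky]]; exists (maxn n k) => //; split.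
    - by move: x Fnx; exact/subsetPset/ndF/leq_maxl.
    - by move: y Gky; exact/subsetPset/ndG/leq_maxr.
  by move=> [n _ []/= ? ?]; split; exists n.
move=> k; have [? ?] := Foo k; have [? ?] := Goo k.
split; first exact: measurableX.
by rewrite product_measure1E// lte_mul_pinfty// ge0_fin_numE.
Qed.

Section PowerMeasure.
Local Open Scope ereal_scope.
Context d (T : measurableType d) (R : realType).

Definition cons_pair n (p : T * n.-tuple T) : n.+1.-tuple T :=
  [the n.+1.-tuple T of p.1 :: p.2].

Lemma measurable_cons_pair n : measurable_fun [set: T * n.-tuple T] (@cons_pair n).
Proof. exact: measurable_cons. Qed.

Lemma measurable_uncons n :
  measurable_fun [set: n.+1.-tuple T] (fun s => (thead s, [tuple of behead s])).
Proof.
apply/measurable_fun_pairP; split => /=.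
  exact: measurable_tnth.
exact: measurable_behead.
Qed.

Section cons_measure.
Variables (n : nat) (mu : {sigma_finite_measure set T -> \bar R})
  (m : {sigma_finite_measure set (n.-tuple T) -> \bar R}).

Definition cons_measure : set (n.+1.-tuple T) -> \bar R :=
  pushforward (mu \x m) (@cons_pair n).

Let cons_measure0 : cons_measure set0 = 0.
Proof. by rewrite /cons_measure /pushforward preimage_set0 measure0. Qed.

Let cons_measure_ge0 A : 0 <= cons_measure A.
Proof. by rewrite /cons_measure /pushforward; exact: measure_ge0. Qed.

Let cons_measure_sigma_additive : semi_sigma_additive cons_measure.
Proof.
move=> F mF tF mUF; rewrite /cons_measure /pushforward preimage_bigcup.
have mpre A : measurable A -> measurable (@cons_pair n @^-1` A).
  by move=> mA; rewrite -[X in measurable X]setTI; exact: measurable_cons_pair.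
apply: measure_semi_sigma_additive.
- by move=> k; exact: mpre.
- apply/trivIsetP => /= i j _ _ ij; rewrite -preimage_setI.
  by move/trivIsetP : tF => /(_ _ _ _ _ ij) ->//; rewrite preimage_set0.
- by rewrite -preimage_bigcup; exact: mpre.
Qed.

HB.instance Definition _ := isMeasure.Build _ _ _ cons_measure
  cons_measure0 cons_measure_ge0 cons_measure_sigma_additive.

Let cons_measure_sigma_finite : sigma_finite setT cons_measure.
Proof.
have [F TF FP] := product_sigma_finite mu m.
have uK : cancel (@cons_pair n) (fun s => (thead s, [tuple of behead s])).
  by move=> [x s] /=; congr pair; apply: val_inj.
exists (fun k => (fun s => (thead s, [tuple of behead s])) @^-1` F k).
  by rewrite -preimage_bigcup -TF preimage_setT.
move=> k; have [mF Foo] := FP k; split.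
  by rewrite -[X in measurable X]setTI; exact: measurable_uncons.
rewrite /cons_measure /pushforward -comp_preimage.
rewrite (_ : _ \o _ = id) ?preimage_id//.
by apply/funext => p; exact: uK.
Qed.

HB.instance Definition _ := Measure_isSigmaFinite.Build _ _ _ cons_measure
  cons_measure_sigma_finite.

End cons_measure.

Variable mu : {sigma_finite_measure set T -> \bar R}.

(* The n-fold product measure on n-tuples. *)
Fixpoint power_measure n : {sigma_finite_measure set (n.-tuple T) -> \bar R} :=
  match n with
  | 0 => \d_[tuple]
  | n'.+1 => cons_measure mu (power_measure n')
  end.

Lemma power_measure_box n (A : 'I_n -> set T) : (forall i, measurable (A i)) ->
  power_measure n [set s | forall i, A i (tnth s i)] = \prod_(i < n) mu (A i).
Proof.
elim: n A => [A _|n IHn A mA].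
  by rewrite big_ord0 /= diracE mem_set// => -[].
have mbox : measurable
    [set s : n.-tuple T | forall i, A (lift ord0 i) (tnth s i)].
  rewrite (_ : [set _ | _] =
    \bigcap_(i in [set: 'I_n]) ((fun s => tnth s i) @^-1` A (lift ord0 i))).
    apply: fin_bigcap_measurable => // i _.
    by rewrite -[X in measurable X]setTI; exact: measurable_tnth.
  by apply/seteqP; split=> s /= h i => [_|]; exact: h.
rewrite big_ord_recl -IHn; last by move=> i; exact: mA.
rewrite -product_measure1E //.
rewrite /= /cons_measure /pushforward; congr (product_measure1 _ _ _).
apply/seteqP; split=> -[x s]/=.
  move=> h; split; first exact: (h ord0).
  by move=> i; have := h (lift ord0 i); rewrite tnthS.
move=> [Ax As] i; case: (unliftP ord0 i) => [j ->|->//].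
by rewrite tnthS; exact: As.
Qed.

End PowerMeasure.

Section ExponentialFamily.
Context d (T : measurableType d) (R : realType).

(* f, seen only on D, is a probability density with respect to mu. *)
Definition is_density d' (U : measurableType d') (mu : {measure set U -> \bar R})
    (D : set U) (f : U -> R) :=
  [/\ measurable_fun D f, (forall x, D x -> 0 <= f x) &
      (\int[mu]_(x in D) (f x)%:E = 1)%E].

(* Difference quotients are only taken inside D, so that derivatives at an
   endpoint of an interval D are one-sided, and f is irrelevant outside D. *)
Definition derivable_within (D : set R) (f : R -> R) (x : R) :=
  cvg ((f y - f x) / (y - x) @[y --> within D (x^')]).

(* Equals 0 when the limit does not exist; in particular a positive value
   entails that it does. *)
Definition derive_within (D : set R) (f : R -> R) (x : R) : R :=
  lim ((f y - f x) / (y - x) @[y --> within D (x^')]).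

Definition expfam (eta A : R -> R) (S B : T -> R) (theta : R) (x : T) : R :=
  expR (eta theta * S x - A (eta theta) - B x).

Variables (p : R -> T -> R) (Theta : set R) (prior : R -> R).

Definition likelihood (theta : R) n (s : n.-tuple T) : R :=
  \prod_(i < n) p theta (tnth s i).

Local Notation lebesgue := (@lebesgue_measure R).

Definition marginal n (s : n.-tuple T) : \bar R :=
  (\int[lebesgue]_(theta in Theta) (likelihood theta s * prior theta)%:E)%E.

(* The marginal may be +oo on a null set of samples, where x / +oo = 0. *)
Definition posterior (theta : R) n (s : n.-tuple T) : \bar R :=
  ((likelihood theta s * prior theta)%:E / marginal s)%E.

Definition expected_posterior (nu : {sigma_finite_measure set T -> \bar R})
    (theta0 theta1 : R) (n : nat) : \bar R :=
  (\int[power_measure nu n]_s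
     (posterior theta0 s * (likelihood theta1 s)%:E))%E.

End ExponentialFamily.

(* Main.v *)
Require Import Defs.
From mathcomp Require Import all_boot all_order all_algebra.
From mathcomp Require Import ring lra.
From mathcomp Require Import all_classical all_reals all_analysis measurable_realfun.
Import Order.TTheory GRing.Theory Num.Theory.
Import numFieldNormedType.Exports.
Local Open Scope classical_set_scope.
Local Open Scope ring_scope.

Set Implicit Arguments.
Unset Strict Implicit.
Unset Printing Implicit Defensive.

(** Put the natural parameter [eta] at the centre: let [ts] be the parameter
    whose natural parameter is the mean of those of [theta0] and [theta1].  The
    product of the densities at [theta0] and [theta1] is then [r] times the
    square of the density at [ts], where [r < 1] is the square of the affinity
    of the two ([likelihood_midpoint], [affinity_lt1]).  Hence
    [expected_posterior] is, up to the factor [prior theta0], equal to [r ^+ n]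
    times [E n], the integral of [lik ts ^+ 2 / marginal]
    ([expected_posteriorE]); here [E n] is the mean at [ts] of the posterior
    density at [ts], divided by the prior density.  It is finite and at least 1
    ([expected_self_posterior_lty], [integral_self_posterior_ge1]), so it is
    enough that [E n.+1 <= (1 + eps) * E n] from some [n] on, for every
    [eps > 0] ([expected_self_posterior_growth]): taking [eps] with
    [r * (1 + eps) < 1] gives the strict decrease.

    This growth bound rests on log-concavity.  Fix symmetric points [tl] and
    [tr] around [ts].  The log-likelihood is concave in the natural
    parameter, because the log-partition function is convex.  So if the
    likelihoods at [tl] and [tr] are exponentially smaller than the one at
    [ts], then the posterior mass outside [[tl, tr]] is negligible
    ([concentrated_or_atypical]), and a further observation [x] multiplies the
    marginal by at least about the smaller of the densities of [x] at [tl] and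
    [tr].  The resulting growth factor is governed by the integral of the
    larger of these two densities, close to 1 when [tl] and [tr] are close
    ([integral_max_density_le]).  On the other samples the likelihood at [ts]
    is at most [q ^+ n] times the sum of the likelihoods at two intermediate
    points, with [q < 1].  There the inverse of the marginal is controlled by
    the bound [marginal >= c * k ^+ n * lik ts], valid for every sample and with
    [k] as close to 1 as desired ([weight_lower_symmetric]); once [k > q], these
    samples contribute a vanishing amount. *)

(** * Functions with a positive derivative within an interval *)

Section WithinInterval.
Variables (R : realType) (D : set R) (f : R -> R).

Lemma near_within_dnbhsP (P : set R) (x : R) :
  within D (x^') P <->
  exists2 e, 0 < e & forall y, `|x - y| < e -> y != x -> D y -> P y.
Proof.
split=> [/nbhs_ballP[e /= e0 h]|[e e0 h]].
  by exists e => // y xye yx Dy; exact: h.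
by apply/nbhs_ballP; exists e => //= y xye yx Dy; exact: h.
Qed.

Lemma derivable_within_continuous :
  (forall x, D x -> derivable_within D f x) -> {within D, continuous f}.
Proof.
move=> df; apply/subspace_continuousP => x Dx.
have /cvg_ex [l fl] := df x Dx.
apply/cvgrPdist_le => e e0.
have /cvgrPdist_lt /(_ 1 ltr01) /near_within_dnbhsP [e1 e10 near_q] := fl.
have l0 : 0 < `|l| + 1 by rewrite ltr_wpDl.
apply/nbhs_ballP; exists (Num.min e1 (e / (`|l| + 1))) => /=.
  by rewrite lt_min e10 divr_gt0.
move=> y; rewrite /ball/= lt_min => /andP[xy1 xy] Dy.
have [->|yx] := eqVneq y x; first by rewrite subrr normr0 ltW.
have q1 : `|l - (f y - f x) / (y - x)| < 1 by exact: near_q.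
have yx0 : y - x != 0 by rewrite subr_eq0.
rewrite /from_subspace distrC -[f y - f x](divfK yx0) normrM.
apply: le_trans (_ : (`|l| + 1) * `|y - x| <= _).
  rewrite ler_wpM2r//.
  rewrite (_ : _ / _ = l - (l - (f y - f x) / (y - x))); last by ring.
  by rewrite (le_trans (ler_normB _ _))// lerD2l ltW.
by rewrite mulrC -ler_pdivlMr// distrC ltW.
Qed.

(** The maximum of [f] on [[a, b]] is attained at [b] only, since at any earlier
    point a positive derivative lets [f] increase further. *)
Lemma derive_within_gt0_incr : is_interval D ->
  (forall x, D x -> derivable_within D f x) ->
  (forall x, D x -> 0 < derive_within D f x) ->
  {in D &, {homo f : x y / x < y}}.
Proof.
move=> iD df df0 a b; rewrite !inE => Da Db ab.
have subD : `[a, b]%classic `<=` D.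
  by move=> x /=; rewrite in_itv/=; exact: iD.
have incr x : a <= x -> x < b -> exists2 y, y \in `[a, b] & f x < f y.
  move=> ax xb; have Dx : D x by apply: subD; rewrite /= in_itv/= ax ltW.
  have /cvgrPdist_lt /(_ _ (df0 x Dx)) /near_within_dnbhsP [e e0 he] := df x Dx.
  (* Within distance e of x, and not beyond b. *)
  pose y := x + Num.min (e / 2) (b - x).
  have m0 : 0 < Num.min (e / 2) (b - x) by rewrite lt_min divr_gt0//= subr_gt0.
  have xy : x < y by rewrite ltrDl.
  have yab : y \in `[a, b].
    rewrite in_itv/= (le_trans ax (ltW xy))/= -lerBrDl ge_min lexx orbT//.
  exists y => //.
  have := he y; rewrite distrC (_ : y - x = Num.min (e / 2) (b - x)); last first.
    by rewrite /y; ring.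
  rewrite gtr0_norm// gt_min ltr_pdivrMr// ltr_pMr// ltr1n => /(_ isT).
  rewrite gt_eqF// => /(_ isT (subD _ yab)).
  rewrite /derive_within; set l := lim _ => h.
  have : 0 < (f y - f x) / Num.min (e / 2) (b - x).
    have := ler_norm (l - (f y - f x) / Num.min (e / 2) (b - x)).
    by move=> /le_lt_trans /(_ h); rewrite ltrBlDl ltrDr.
  by rewrite pmulr_lgt0 ?invr_gt0// subr_gt0.
have cf : {within `[a, b], continuous f}.
  exact/(continuous_subspaceW subD)/derivable_within_continuous.
have [c] := EVT_max (ltW ab) cf; rewrite in_itv/= => /andP[ac cb] maxc.
have cE : c = b.
  apply/eqP; rewrite eq_le cb leNgt; apply/negP => {}cb.
  by have [y /maxc + /lt_le_trans h] := incr c ac cb => /h; rewrite ltxx.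
have [y yab fay] := incr a (lexx a) ab.
by rewrite (lt_le_trans fay)// -cE maxc.
Qed.

End WithinInterval.

Lemma convex_set_is_interval (R : realType) (D : set R) :
  convex_set (D : set (convex_lmodType R^o)) -> is_interval D.
Proof.
move=> cD a b Da Db x /andP[ax xb].
have [ab|ba] := ltP a b; last first.
  by rewrite (_ : x = a)//; apply/eqP; rewrite eq_le ax (le_trans xb).
have ba0 : 0 < b - a by rewrite subr_gt0.
have t01 : 0 <= (b - x) / (b - a) <= 1.
  by rewrite divr_ge0 ?subr_ge0 ?(ltW ab)//= ler_pdivrMr// mul1r lerB.
have := cD a b (Itv01 (andP t01).1 (andP t01).2).
rewrite !inE => /(_ Da Db) Dt.
have <- : (b - x) / (b - a) * a + (1 - (b - x) / (b - a)) * b = x.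
  by field; rewrite gt_eqF.
exact: Dt.
Qed.

Lemma continuous_incr_interp (R : realType) (D : set R) (f : R -> R) (a b v : R) :
  is_interval D -> {within D, continuous f} -> {in D &, {homo f : x y / x < y}} ->
  D a -> D b -> f a <= v <= f b -> exists2 c, D c & f c = v.
Proof.
move=> iD cf incf Da Db /andP[av vb].
have ab : a <= b.
  rewrite leNgt; apply/negP => /incf; rewrite !inE => /(_ Db Da).
  by rewrite ltNge (le_trans av vb).
have subD : `[a, b]%classic `<=` D.
  by move=> x /=; rewrite in_itv/=; exact: iD.
have [] := @IVT _ f a b v ab; first exact: continuous_subspaceW cf.
  by rewrite ge_min le_max av vb orbT.
by move=> c cab <-; exists c => //; exact: subD.
Qed.

Lemma derive_within_locally_affine (R : realType) (D : set R) (f : R -> R)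
    (a b c x : R) :
  `[a, b]%classic `<=` D -> a < x -> x < b ->
  (forall y, a <= y -> y <= b -> f y = f x + c * (y - x)) ->
  derive_within D f x = c.
Proof.
move=> subD ax xb fE.
have m0 e : 0 < e -> 0 < Num.min e (Num.min (x - a) (b - x)).
  by move=> e0; rewrite !lt_min e0 !subr_gt0 ax xb.
have Fproper : ProperFilter (within D (x^')).
  apply: Build_ProperFilter_ex => P /near_within_dnbhsP[e e0 h].
  pose d := Num.min (e / 2) (Num.min (x - a) (b - x)).
  have d0 : 0 < d by apply: m0; rewrite divr_gt0.
  exists (x + d); apply: h.
  - rewrite opprD addNKr normrN gtr0_norm// gt_min ltr_pdivrMr//.
    by rewrite ltr_pMr// ltr1n.
  - by rewrite gt_eqF// ltrDl.
  - apply: subD; rewrite /= in_itv/= (le_trans (ltW ax)) ?lerDl ?(ltW d0)//=.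
    by rewrite -lerBrDl /d !ge_min lexx !orbT.
apply: cvg_lim => //; apply/cvgrPdist_lt => e e0.
apply/near_within_dnbhsP; exists (Num.min (x - a) (b - x)).
  by rewrite lt_min !subr_gt0 ax.
move=> y + yx _; rewrite lt_min !ltr_norml => /andP[/andP[? ?] /andP[? ?]].
rewrite fE; [|lra|lra].
rewrite (_ : (_ + _ - _) / _ = c) ?subrr ?oppr_lt0 ?e0//.
by field; rewrite subr_eq0.
Qed.

(** * Convex functions *)

Section StrictMidpoint.
Variables (R : realType) (D : set R) (A : R -> R).
Hypothesis iD : is_interval D.
Hypothesis cA : forall a b t, D a -> D b -> 0 <= t -> t <= 1 ->
  A (t * a + (1 - t) * b) <= t * A a + (1 - t) * A b.

Lemma convex_chord a b x : D a -> D b -> a < b -> a <= x -> x <= b ->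
  A x * (b - a) <= A a * (b - x) + A b * (x - a).
Proof.
move=> Da Db ab ax xb; have ba0 : 0 < b - a by rewrite subr_gt0.
have := @cA a b ((b - x) / (b - a)) Da Db.
rewrite divr_ge0 ?subr_ge0 ?(ltW ab)//= ler_pdivrMr// mul1r lerB// => /(_ isT isT).
rewrite (_ : _ * a + _ = x); last by field; rewrite gt_eqF.
rewrite -(ler_pM2r ba0) => /le_trans; apply.
by rewrite le_eqVlt; apply/orP; left; apply/eqP; field; rewrite gt_eqF.
Qed.

(** If a convex function meets its chord at the midpoint then it is affine on
    the whole segment, so that its second derivative vanishes there. *)
Lemma convex_midpoint_lt a b : D a -> D b -> a < b ->
  0 < derive_within D (derive_within D A) ((a + b) / 2) ->
  2 * A ((a + b) / 2) < A a + A b.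
Proof.
move=> Da Db ab; apply: contraLR; rewrite -!leNgt; set m := (a + b) / 2 => hm.
have am : a < m by rewrite /m midf_lt.
have mb : m < b by rewrite /m midf_lt.
have Dab x : a <= x -> x <= b -> D x by move=> *; apply: (iD Da Db); apply/andP.
have mE : m = (a + b) / 2 by [].
have Dm : D m by apply: Dab; exact: ltW.
pose c := (A b - A a) / (b - a).
have ba0 : b - a != 0 by rewrite subr_eq0 gt_eqF.
have AbE : A b = A a + c * (b - a) by rewrite /c divfK// addrC subrK.
have Aaff x : a <= x -> x <= b -> A x = A a + c * (x - a).
  move=> ax xb; have Dx := Dab x ax xb.
  have U : A x <= A a + c * (x - a).
    have := convex_chord Da Db ab ax xb; rewrite AbE => U.
    by rewrite -(@ler_pM2r _ (b - a)) ?subr_gt0// (le_trans U)//; nra.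
  apply/eqP; rewrite eq_le U /=.
  have hm' : A a + c * (m - a) <= A m by move: hm; rewrite AbE mE; lra.
  have [xm|xm|->//] := ltgtP x m.
    have := convex_chord Dx Db (lt_trans xm mb) (ltW xm) (ltW mb).
    have : 0 <= b - x by rewrite subr_ge0.
    move=> /ler_wpM2r /(_ _ _ hm'); rewrite AbE => h1 h2.
    rewrite -(@ler_pM2r _ (b - m)) ?subr_gt0//.
    by rewrite -subr_ge0 in h1; rewrite -subr_ge0 in h2; lra.
  have := convex_chord Da Dx (lt_trans am xm) (ltW am) (ltW xm).
  have : 0 <= x - a by rewrite subr_ge0.
  move=> /ler_wpM2r /(_ _ _ hm') h1 h2.
  rewrite -(@ler_pM2r _ (m - a)) ?subr_gt0//.
  by rewrite -subr_ge0 in h1; rewrite -subr_ge0 in h2; lra.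
have A'E x : a < x -> x < b -> derive_within D A x = c.
  move=> ax xb; apply: (@derive_within_locally_affine _ _ _ a b) => //.
    by move=> y /=; rewrite in_itv/= => /andP[]; exact: Dab.
  by move=> y ay yb; rewrite (Aaff y)// (Aaff x) ?ltW//; ring.
rewrite (@derive_within_locally_affine _ _ _ ((a + m) / 2) ((m + b) / 2) 0)//.
- move=> y /=; rewrite in_itv/= => /andP[? ?].
  by apply: Dab; lra.
- by lra.
- by lra.
- move=> y ? ?; rewrite mul0r addr0 !A'E//; lra.
Qed.
End StrictMidpoint.

(** * Integrals of densities and product measures *)

Lemma integral_densityZ d (T : measurableType d) (R : realType)
    (mu : {measure set T -> \bar R}) (D : set T) (f : T -> R) (c : R) :
  measurable D -> is_density mu D f -> 0 <= c ->
  (\int[mu]_(x in D) (c * f x)%:E)%E = c%:E.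
Proof.
move=> mD [mf f0 f1] c0; under eq_integral do rewrite EFinM.
by rewrite ge0_integralZl_EFin ?f1 ?mule1//; exact/measurable_EFinP.
Qed.

Section PowerMeasureIntegral.
Context d (T : measurableType d) (R : realType).
Variable nu : {sigma_finite_measure set T -> \bar R}.

Lemma integral_power_measureS n (f : n.+1.-tuple T -> \bar R) :
  measurable_fun setT f -> (forall s, 0 <= f s)%E ->
  (\int[power_measure nu n.+1]_s f s =
   \int[power_measure nu n]_s \int[nu]_x f (cons_pair (x, s)))%E.
Proof.
move=> mf f0; rewrite /= /cons_measure.
rewrite ge0_integral_pushforward//; last exact: measurable_cons_pair.
rewrite preimage_setT fubini_tonelli2//; last by move=> x; exact: f0.
by apply: measurableT_comp => //; exact: measurable_cons_pair.
Qed.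

Lemma measurable_likelihood (p : R -> T -> R) theta n :
  measurable_fun setT (p theta) -> measurable_fun setT (@likelihood _ _ R p theta n).
Proof.
move=> mp; rewrite /likelihood; apply: measurable_prod => i _.
by apply: measurableT_comp => //; exact: measurable_tnth.
Qed.

Lemma likelihood_cons (p : R -> T -> R) theta n x (s : n.-tuple T) :
  likelihood p theta (cons_pair (x, s)) = p theta x * likelihood p theta s.
Proof.
rewrite /likelihood big_ord_recl; congr (_ * _).
by apply: eq_bigr => i _; rewrite tnthS.
Qed.

Lemma likelihood_density (p : R -> T -> R) theta n :
  is_density nu setT (p theta) ->
  is_density (power_measure nu n) setT (@likelihood _ _ R p theta n).
Proof.
move=> p1; have [mp p0 _] := p1.
have l0 k (s : k.-tuple T) : 0 <= likelihood p theta s.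
  by apply: prodr_ge0 => i _; exact: p0.
split=> //; first exact: measurable_likelihood.
elim: n => [|n IHn].
  rewrite /= integral_dirac//; first by rewrite diracT mul1e /likelihood big_ord0.
  by apply/measurable_EFinP; exact: measurable_likelihood.
rewrite integral_power_measureS//; last 2 first.
- by apply/measurable_EFinP; exact: measurable_likelihood.
- by move=> s; rewrite lee_fin.
rewrite -[RHS]IHn; apply: eq_integral => s _.
under eq_integral do rewrite likelihood_cons mulrC.
exact: integral_densityZ.
Qed.

End PowerMeasureIntegral.

(** * The likelihood of an exponential family *)

Section ExponentialFamilyLikelihood.
Context d (T : measurableType d) (R : realType).
Variables (nu : {sigma_finite_measure set T -> \bar R}).
Variables (Theta : set R) (eta A : R -> R) (S B : T -> R).
Hypothesis p_density : forall theta, Theta theta ->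
  is_density nu [set: T] (expfam eta A S B theta).

Local Notation p := (expfam eta A S B).
Local Notation lik := (likelihood p).

Lemma likelihood_gt0 theta n (s : n.-tuple T) : 0 < lik theta s.
Proof. by apply: prodr_gt0 => i _; exact: expR_gt0. Qed.

Lemma likelihoodE theta n (s : n.-tuple T) :
  lik theta s = expR (eta theta * (\sum_(i < n) S (tnth s i)) -
    n%:R * A (eta theta) - \sum_(i < n) B (tnth s i)).
Proof.
rewrite /likelihood /expfam -expR_sum !sumrB -mulr_sumr.
by rewrite sumr_const card_ord mulr_natl.
Qed.

(** Integrating the convexity inequality of the exponential function along the
    geometric mixture of two members of the family gives the convexity of the
    log-partition function. *)
Lemma log_partition_convex a b theta t :
  Theta a -> Theta b -> Theta theta -> 0 <= t -> t <= 1 ->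
  eta theta = t * eta a + (1 - t) * eta b ->
  A (eta theta) <= t * A (eta a) + (1 - t) * A (eta b).
Proof.
move=> Ta Tb Tt t0 t1 etaE.
have t1' : 0 <= 1 - t by rewrite subr_ge0.
set e := t * A (eta a) + (1 - t) * A (eta b).
have young x : expR (A (eta theta) - e) * p theta x <= t * p a x + (1 - t) * p b x.
  pose u := eta a * S x - A (eta a) - B x.
  pose v := eta b * S x - A (eta b) - B x.
  have : expR (t * u + (1 - t) * v) <= t * expR u + (1 - t) * expR v :=
    convex_expR (Itv01 t0 t1) u v.
  apply: le_trans.
  rewrite /expfam -expRD ler_expR etaE /e /u /v le_eqVlt; apply/orP; left; apply/eqP.
  by ring.
have mp c : Theta c -> measurable_fun setT (p c) by case/p_density.
rewrite -subr_le0 -expR_le1 -lee_fin.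
rewrite -(integral_densityZ measurableT (p_density Tt) (expR_ge0 _)).
have -> : 1%:E = (\int[nu]_x (t * p a x + (1 - t) * p b x)%:E)%E.
  under [RHS]eq_integral do rewrite EFinD.
  rewrite ge0_integralD//.
  - rewrite !integral_densityZ//; try exact: p_density.
    by rewrite -EFinD addrC subrK.
  - by move=> x _; rewrite lee_fin mulr_ge0 ?expR_ge0.
  - by apply/measurable_EFinP/measurable_funM => //; exact: mp.
  - by move=> x _; rewrite lee_fin mulr_ge0 ?expR_ge0.
  - by apply/measurable_EFinP/measurable_funM => //; exact: mp.
apply: ge0_le_integral => //.
- by move=> x _; rewrite lee_fin mulr_ge0 ?expR_ge0.
- by apply/measurable_EFinP/measurable_funM => //; exact: mp.
- by apply/measurable_EFinP/measurable_funD; apply: measurable_funM => //; exact: mp.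
- by move=> x _; rewrite lee_fin.
Qed.

(** The log-likelihood is linear minus convex in the natural parameter, hence
    concave; its minimum over a segment is at an endpoint. *)
Lemma likelihood_quasi_concave a b theta n (s : n.-tuple T) :
  Theta a -> Theta b -> Theta theta -> eta a <= eta theta -> eta theta <= eta b ->
  Num.min (lik a s) (lik b s) <= lik theta s.
Proof.
move=> Ta Tb Tt at_ tb.
have [ab|ab] := eqVneq (eta a) (eta b).
  have -> : lik theta s = lik a s.
    by rewrite !likelihoodE (_ : eta theta = eta a)//; apply/eqP; rewrite eq_le at_ ab tb.
  by rewrite ge_min lexx.
have ab0 : 0 < eta b - eta a by rewrite subr_gt0 lt_neqAle ab (le_trans at_).
pose t := (eta b - eta theta) / (eta b - eta a).
have t0 : 0 <= t by rewrite divr_ge0 ?(ltW ab0)// subr_ge0.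
have t1 : t <= 1 by rewrite ler_pdivrMr// mul1r lerD2l lerN2.
have etaE : eta theta = t * eta a + (1 - t) * eta b.
  by rewrite /t; field; rewrite gt_eqF.
have := log_partition_convex Ta Tb Tt t0 t1 etaE.
rewrite !likelihoodE; set U := \sum_(i < n) _; set V := \sum_(i < n) _ => cA.
clearbody t.
pose la c := eta c * U - n%:R * A (eta c) - V.
have key : t * la a + (1 - t) * la b <= la theta.
  have := ler_wpM2l (ler0n R n) cA.
  by rewrite /la etaE; lra.
have [lab|lba] := leP (la a) (la b).
  rewrite ge_min ler_expR; apply/orP; left; apply: le_trans key.
  have := ler_wpM2l (_ : 0 <= 1 - t) lab; rewrite subr_ge0 => /(_ t1).
  by rewrite -/(la a); lra.
rewrite ge_min !ler_expR; apply/orP; right; apply: le_trans key.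
by have := ler_wpM2l t0 (ltW lba); rewrite -/(la b); lra.
Qed.

Lemma density_quasi_concave a b t x : Theta a -> Theta b -> Theta t ->
  eta a <= eta t -> eta t <= eta b -> Num.min (p a x) (p b x) <= p t x.
Proof.
move=> Ta Tb Tt ta_t t_tb.
have := likelihood_quasi_concave [tuple x] Ta Tb Tt ta_t t_tb.
by rewrite /likelihood !big_ord1 (tnth_nth x).
Qed.

(** The Bhattacharyya coefficient (the integral of the geometric mean) of the
    densities at [a] and [b], when [eta m] is the mean of [eta a] and
    [eta b]. *)
Definition affinity (a b m : R) : R :=
  expR (A (eta m) - (A (eta a) + A (eta b)) / 2).

Lemma affinity_gt0 a b m : 0 < affinity a b m.
Proof. exact: expR_gt0. Qed.

Lemma affinity_le1 a b m : Theta a -> Theta b -> Theta m ->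
  eta a + eta b = 2 * eta m -> affinity a b m <= 1.
Proof.
move=> Ta Tb Tm mid; have h2 : 2^-1 <= 1 :> R by rewrite invf_le1// ler1n.
have := @log_partition_convex a b m 2^-1 Ta Tb Tm.
rewrite invr_ge0 ler0n => /(_ isT h2).
rewrite (_ : 1 - 2^-1 = 2^-1); last by lra.
rewrite -mulrDr mid mulKf ?pnatr_eq0// => /(_ erefl).
by rewrite /affinity expR_le1; lra.
Qed.

(** The geometric mean of two likelihoods is, up to a constant per
    observation, the likelihood at the midpoint of the natural parameters. *)
Lemma likelihood_midpoint a b m n (s : n.-tuple T) :
  eta a + eta b = 2 * eta m ->
  lik a s * lik b s = (affinity a b m ^+ n * lik m s) ^+ 2.
Proof.
move=> mid; rewrite /affinity -expRM_natl !likelihoodE -!expRD -expRM_natl.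
congr expR; set U := \sum_(i < n) _; set V := \sum_(i < n) _.
have -> : eta b = 2 * eta m - eta a by rewrite -mid; ring.
by field.
Qed.

Lemma density_midpoint a b m x : eta a + eta b = 2 * eta m ->
  p a x * p b x = (affinity a b m * p m x) ^+ 2.
Proof.
move=> mid; have := likelihood_midpoint [tuple x] mid.
by rewrite /likelihood !big_ord1 expr1 (tnth_nth x).
Qed.

Hypothesis iTheta : is_interval Theta.
Hypothesis eta_cont : {within Theta, continuous eta}.
Hypothesis eta_incr : {in Theta &, {homo eta : x y / x < y}}.
Hypothesis A''_gt0 : forall theta, Theta theta ->
  0 < derive_within (eta @` Theta) (derive_within (eta @` Theta) A) (eta theta).

Lemma natural_interval : is_interval (eta @` Theta).
Proof.
move=> _ _ [a Ta <-] [b Tb <-] v ave.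
have [t Tt <-] := continuous_incr_interp iTheta eta_cont eta_incr Ta Tb ave.
by exists t.
Qed.

(** Equality would make the log-partition function affine between [eta a] and
    [eta b], against the positivity of its second derivative. *)
Lemma affinity_lt1 a b m : Theta a -> Theta b -> Theta m -> a != b ->
  eta a + eta b = 2 * eta m -> affinity a b m < 1.
Proof.
move=> Ta Tb Tm ab mid.
have cA u v t : (eta @` Theta) u -> (eta @` Theta) v -> 0 <= t -> t <= 1 ->
    A (t * u + (1 - t) * v) <= t * A u + (1 - t) * A v.
  move=> [a' Ta' <-] [b' Tb' <-] t0 t1.
  wlog ab' : a' b' t Ta' Tb' t0 t1 / eta a' <= eta b'.
    move=> H; have /orP[le|le] := le_total (eta a') (eta b'); first exact: H.
    have := H _ _ (1 - t) Tb' Ta' _ _ le; rewrite subr_ge0 gerBl => /(_ t1 t0).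
    by rewrite subKr addrC [leRHS]addrC.
  have [s Ts sE] : exists2 s, Theta s & eta s = t * eta a' + (1 - t) * eta b'.
    apply: (continuous_incr_interp iTheta eta_cont eta_incr Ta' Tb').
    by apply/andP; split; nra.
  by rewrite -sE; exact: (log_partition_convex Ta' Tb' Ts t0 t1 sE).
have mE : eta m = (eta a + eta b) / 2 by rewrite mid mulrC mulKf.
have Im t : Theta t -> (eta @` Theta) (eta t) by move=> Tt; exists t.
have A''m := A''_gt0 Tm; rewrite mE in A''m.
have Amid : 2 * A (eta m) < A (eta a) + A (eta b).
  rewrite mE; have [lt|lt|ab0] := ltgtP a b; last by rewrite ab0 eqxx in ab.
    apply: (convex_midpoint_lt natural_interval cA (Im _ Ta) (Im _ Tb)) => //.
    by rewrite eta_incr// inE.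
  rewrite addrC [ltRHS]addrC.
  apply: (convex_midpoint_lt natural_interval cA (Im _ Tb) (Im _ Ta)) => //.
    by rewrite eta_incr// inE.
  by rewrite addrC.
by rewrite /affinity expR_lt1; lra.
Qed.

End ExponentialFamilyLikelihood.

(** * The marginal density *)

Section Marginal.
Context d (T : measurableType d) (R : realType).
Variables (nu : {sigma_finite_measure set T -> \bar R}).
Variables (Theta : set R) (prior eta A : R -> R) (S B : T -> R).
Hypothesis p_density : forall theta, Theta theta ->
  is_density nu [set: T] (expfam eta A S B theta).
Hypothesis prior_density : is_density lebesgue_measure Theta prior.
Hypothesis iTheta : is_interval Theta.
Hypothesis eta_cont : {within Theta, continuous eta}.
Hypothesis eta_incr : {in Theta &, {homo eta : x y / x < y}}.
Variables (ta tb : R).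
Hypothesis (Tta : Theta ta) (Ttb : Theta tb) (tab : ta < tb).

Local Notation p := (expfam eta A S B).
Local Notation lik := (likelihood p).
Local Notation leb := (@lebesgue_measure R).

Let mTheta : measurable Theta := is_interval_measurable iTheta.

Lemma eta_lt u v : Theta u -> Theta v -> u < v -> eta u < eta v.
Proof. by move=> Tu Tv uv; rewrite eta_incr// inE. Qed.

Lemma eta_lt_inv u v : Theta u -> Theta v -> eta u < eta v -> u < v.
Proof.
move=> Tu Tv uv; rewrite ltNge le_eqVlt; apply/negP => /predU1P[vu|vu].
  by move: uv; rewrite vu ltxx.
by move: uv; rewrite ltNge ltW// eta_lt.
Qed.

Lemma eta_le u v : Theta u -> Theta v -> u <= v -> eta u <= eta v.
Proof.
by move=> Tu Tv; rewrite le_eqVlt => /predU1P[->//|uv]; rewrite ltW// eta_lt.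
Qed.

Lemma measurable_eta : measurable_fun Theta eta.
Proof. exact: subspace_continuous_measurable_fun. Qed.

(** Convexity makes the sublevel sets of the log-partition function intervals.
    This also covers the endpoints of [Theta], where a convex function may
    jump. *)
Lemma measurable_log_partition : measurable_fun Theta (fun theta => A (eta theta)).
Proof.
apply: (measurability _ (RGenInftyO.measurableE R)) => _ [_ [r ->] <-].
apply: is_interval_measurable => a b [Ta /= Aa] [Tb /= Ab] x /andP[ax xb].
rewrite !in_itv/= in Aa Ab *.
have Tx : Theta x by apply: (iTheta Ta Tb); rewrite ax.
split=> //.
have [xa|ab] := leP b a.
  have -> : x = a by apply/eqP; rewrite eq_le ax (le_trans xb).
  by [].
have eab : 0 < eta b - eta a by rewrite subr_gt0 eta_incr// inE.
pose t := (eta b - eta x) / (eta b - eta a).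
have t0 : 0 <= t by rewrite divr_ge0 ?(ltW eab)// subr_ge0 eta_le.
have t1 : t <= 1 by rewrite ler_pdivrMr// mul1r lerD2l lerN2 eta_le.
have etaE : eta x = t * eta a + (1 - t) * eta b.
  by rewrite /t; field; rewrite gt_eqF.
apply: le_lt_trans (log_partition_convex p_density Ta Tb Tx t0 t1 etaE) _.
clearbody t; have [m|m] := leP (A (eta a)) (A (eta b)); nra.
Qed.

(** The statistic is an affine function of the logarithm of the likelihood ratio
    of any two members of the family. *)
Lemma measurable_statistic : measurable_fun setT S.
Proof.
have e0 : eta tb - eta ta != 0.
  by rewrite gt_eqF// subr_gt0 eta_incr// inE.
have -> : S = (fun x => (ln (p tb x) - ln (p ta x) +
    (A (eta tb) - A (eta ta))) / (eta tb - eta ta)).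
  by apply/funext => x; rewrite /expfam !expRK; field.
have [mb _ _] := p_density Ttb; have [ma _ _] := p_density Tta.
apply: measurable_funM => //; apply: measurable_funD => //.
by apply: measurable_funB; apply: measurableT_comp => //; exact: measurable_ln.
Qed.

Lemma measurable_carrier : measurable_fun setT B.
Proof.
have -> : B = (fun x => eta ta * S x - A (eta ta) - ln (p ta x)).
  by apply/funext => x; rewrite /expfam !expRK; ring.
have [ma _ _] := p_density Tta.
apply: measurable_funB; last first.
  by apply: measurableT_comp => //; exact: measurable_ln.
apply: measurable_funB => //; apply: measurable_funM => //.
exact: measurable_statistic.
Qed.

(** The joint density of the sample and the parameter, extended by 0 outside
    [Theta] so as to be measurable on the whole product space. *)
Definition joint n (z : n.-tuple T * R) : R :=
  expR ((eta \_ Theta) z.2 * (\sum_(i < n) S (tnth z.1 i)) -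
    n%:R * ((A \o eta) \_ Theta) z.2 - \sum_(i < n) B (tnth z.1 i)) *
  (prior \_ Theta) z.2.

Lemma joint_ge0 n (z : n.-tuple T * R) : 0 <= joint z.
Proof.
rewrite /joint mulr_ge0 ?expR_ge0// patchE; case: ifPn => // zT.
by have [_ + _] := prior_density; apply; rewrite -in_setE.
Qed.

Lemma jointE n (s : n.-tuple T) theta :
  joint (s, theta) = ((fun t => lik t s * prior t) \_ Theta) theta.
Proof.
rewrite /joint/= !patchE; case: ifPn => zT; last by rewrite mulr0.
by rewrite likelihoodE.
Qed.

Lemma measurable_joint n : measurable_fun setT (@joint n).
Proof.
have restr (f : R -> R) : measurable_fun Theta f ->
    measurable_fun setT (fun z : n.-tuple T * R => (f \_ Theta) z.2).
  move=> mf; apply: measurableT_comp => //.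
  exact/(measurable_restrictT _ mTheta).
have stat (f : T -> R) : measurable_fun setT f ->
    measurable_fun setT (fun z : n.-tuple T * R => \sum_(i < n) f (tnth z.1 i)).
  move=> mf; apply: measurable_sum => i.
  apply: (measurableT_comp mf).
  apply: (measurableT_comp (measurable_tnth i)).
  exact: measurable_fst.
have [mprior _ _] := prior_density.
apply: measurable_funM; last exact: restr.
apply: measurableT_comp => //; apply: measurable_funB.
  apply: measurable_funB; apply: measurable_funM => //.
- by apply: restr; exact: measurable_eta.
- by apply: stat; exact: measurable_statistic.
- by apply: restr; exact: measurable_log_partition.
by apply: stat; exact: measurable_carrier.
Qed.

Lemma marginal_joint n (s : n.-tuple T) :
  marginal p Theta prior s = (\int[leb]_theta (joint (s, theta))%:E)%E.
Proof.
rewrite /marginal integral_mkcond; apply: eq_integral => t _.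
by rewrite jointE !patchE; case: ifP.
Qed.

Lemma measurable_marginal n :
  measurable_fun setT (@marginal _ T R p Theta prior n).
Proof.
rewrite (_ : @marginal _ _ _ _ _ _ _ =
  fubini_F leb (EFin \o @joint n)); last first.
  by apply/funext => s; rewrite marginal_joint.
apply: measurable_fun_fubini_tonelli_F.
  by apply/measurable_EFinP; exact: measurable_joint.
by move=> z; rewrite lee_fin joint_ge0.
Qed.

Lemma integral_marginal n :
  (\int[power_measure nu n]_s marginal p Theta prior s = 1)%E.
Proof.
under eq_integral do rewrite marginal_joint.
rewrite [LHS](@fubini_tonelli _ _ _ _ _ (power_measure nu n) leb
  (EFin \o @joint n)); last 2 first.
- by apply/measurable_EFinP; exact: measurable_joint.
- by move=> z; rewrite lee_fin joint_ge0.
have [_ prior0 <-] := prior_density; rewrite [RHS]integral_mkcond.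
apply: eq_integral => t _; rewrite patchE /=; case: ifPn => tT.
  have Tt : Theta t by rewrite -in_setE.
  under eq_integral do rewrite jointE patchE tT mulrC.
  apply: integral_densityZ => //; last exact: prior0.
  by apply: likelihood_density; exact: p_density.
under eq_integral do rewrite jointE patchE (negbTE tT).
by rewrite integral0.
Qed.

Lemma measurable_posterior_weight n (s : n.-tuple T) :
  measurable_fun Theta (fun theta => lik theta s * prior theta).
Proof.
apply/(measurable_restrictT _ mTheta).
rewrite (_ : _ \_ _ = (fun theta => joint (s, theta))).
  by apply: measurableT_comp; [exact: measurable_joint|exact: measurable_pair1].
by apply/funext => t; rewrite jointE.
Qed.

Hypothesis prior_gt0 : forall theta, Theta theta -> 0 < prior theta.

(* The unnormalised posterior mass of U. *)
Local Notation weight U s :=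
  (\int[leb]_(theta in U) (lik theta s * prior theta)%:E)%E.

Let prior_ge0 theta : Theta theta -> 0 <= prior theta.
Proof. by move=> /prior_gt0/ltW. Qed.

Let measurable_prior : measurable_fun Theta prior.
Proof. by case: prior_density. Qed.

(** A positive function has positive integral over a set of positive measure. *)
Lemma prior_mass_gt0 a b : Theta a -> Theta b -> a < b ->
  exists2 c, 0 < c & (c%:E <= \int[leb]_(theta in `[a, b]) (prior theta)%:E)%E.
Proof.
move=> Ta Tb ab.
have sub : `[a, b]%classic `<=` Theta.
  by move=> x /=; rewrite in_itv/=; exact: iTheta.
have mprior : measurable_fun `[a, b]%classic (EFin \o prior).
  apply/measurable_EFinP; apply: measurable_funS measurable_prior => //.
set I := (\int[leb]_(theta in _) _)%E.
have I0 : (0 <= I)%E.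
  by apply: integral_ge0 => x /sub Tx; rewrite lee_fin prior_ge0.
have I1 : (I <= 1)%E.
  have [mp p0 <-] := prior_density.
  by apply: ge0_subset_integral => //; exact/measurable_EFinP.
have Ifin : I \is a fin_num.
  by rewrite ge0_fin_numE// (le_lt_trans I1)// ltry.
exists (fine I); last by rewrite fineK.
rewrite lt_neqAle fine_ge0// andbT eq_sym; apply/eqP => I00.
have /ae_eq_integral_abs : (\int[leb]_(x in `[a, b]) `|(prior x)%:E| = 0)%E.
  have -> : (0 = I)%E by rewrite -(fineK Ifin) I00.
  apply: eq_integral => x; rewrite inE => /sub Tx.
  by rewrite gee0_abs// lee_fin prior_ge0.
move=> /(_ (measurable_itv _) mprior) [N [mN N0 abN]].
have : (leb `[a, b]%classic <= leb N)%E.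
  apply: le_measure; rewrite ?inE//.
  move=> x xab; apply: abN => /=; apply/not_implyP; split=> //= -[px].
  by have := prior_gt0 (sub x xab); rewrite px ltxx.
rewrite N0 lebesgue_measure_itv/= lte_fin ab -EFinB lee_fin subr_le0.
by rewrite leNgt ab.
Qed.

Section WeightBounds.
Variables (n : nat) (s : n.-tuple T).

Let weight_ge0 theta : Theta theta -> (0 <= (lik theta s * prior theta)%:E)%E.
Proof. by move=> Tt; rewrite lee_fin mulr_ge0 ?prior_ge0// ltW ?likelihood_gt0. Qed.

Let measurable_weight U : measurable U -> U `<=` Theta ->
  measurable_fun U (fun theta => (lik theta s * prior theta)%:E).
Proof.
move=> mU UT; apply/measurable_EFinP.
by apply: measurable_funS (measurable_posterior_weight s).
Qed.

Lemma weight_lower W U k : measurable W -> measurable U -> W `<=` U ->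
  U `<=` Theta -> 0 <= k -> (forall theta, W theta -> k <= lik theta s) ->
  (k%:E * (\int[leb]_(theta in W) (prior theta)%:E) <= weight U s)%E.
Proof.
move=> mW mU WU UT k0 kl; have WT := subset_trans WU UT.
apply: (@le_trans _ _ (weight W s)); last first.
  apply: ge0_subset_integral => //; first exact: measurable_weight.
  by move=> x /UT; exact: weight_ge0.
have mp : measurable_fun W (EFin \o prior).
  by apply/measurable_EFinP; apply: measurable_funS measurable_prior.
rewrite -ge0_integralZl_EFin//; last by move=> x /WT Tx; rewrite lee_fin prior_ge0.
apply: ge0_le_integral => //.
- by move=> x /WT Tx; rewrite -EFinM lee_fin mulr_ge0 ?prior_ge0.
- exact: measurable_funeM.
- exact: measurable_weight.
- move=> x Wx; rewrite -EFinM lee_fin ler_wpM2r//; first exact/prior_ge0/WT.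
  exact: kl.
Qed.

Lemma weight_upper U k : measurable U -> U `<=` Theta -> 0 <= k ->
  (forall theta, U theta -> lik theta s <= k) -> (weight U s <= k%:E)%E.
Proof.
move=> mU UT k0 lk; have [mp p0 p1] := prior_density.
have mpU : measurable_fun U (EFin \o prior).
  by apply/measurable_EFinP; apply: measurable_funS measurable_prior.
apply: (@le_trans _ _ (k%:E * \int[leb]_(theta in U) (prior theta)%:E)%E).
  rewrite -ge0_integralZl_EFin//; last by move=> x /UT Tx; rewrite lee_fin prior_ge0.
  apply: ge0_le_integral => //.
  - by move=> x /UT; exact: weight_ge0.
  - exact: measurable_weight.
  - exact: measurable_funeM.
  - move=> x Ux; rewrite -EFinM lee_fin ler_wpM2r//; first exact/prior_ge0/UT.
    exact: lk.
rewrite -[leRHS]mule1 -p1 lee_wpmul2l ?lee_fin//.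
by apply: ge0_subset_integral => //; exact/measurable_EFinP.
Qed.

Lemma marginal_split U : measurable U -> U `<=` Theta ->
  (marginal p Theta prior s = weight U s + weight (Theta `\` U) s)%E.
Proof.
move=> mU UT; rewrite /marginal -[in LHS](setDUK UT) ge0_integral_setU//.
- exact: measurableD.
- by rewrite setDUK//; exact: measurable_weight.
- by move=> x; rewrite setDUK//; exact: weight_ge0.
- by rewrite disj_set2E setDIK.
Qed.

Lemma weight_le_marginal U : measurable U -> U `<=` Theta ->
  (weight U s <= marginal p Theta prior s)%E.
Proof.
move=> mU UT; by apply: ge0_subset_integral => //; exact: measurable_weight.
Qed.

End WeightBounds.

(** * Concentration of the posterior *)

Local Notation aff := (affinity eta A).

(** One of the two likelihood ratios at symmetric points [tl], [tr] is at least
    the geometric mean of both, and log-concavity spreads this bound over the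
    whole interval between [ts] and that point. *)
Lemma weight_lower_symmetric tl ts tr : Theta tl -> Theta ts -> Theta tr ->
  tl < ts -> ts < tr -> eta tl + eta tr = 2 * eta ts ->
  exists2 c, 0 < c & forall U n (s : n.-tuple T), measurable U -> U `<=` Theta ->
    `[tl, tr]%classic `<=` U ->
    ((c * (aff tl tr ts ^+ n * lik ts s))%:E <= weight U s)%E.
Proof.
move=> Tl Ts Tr lts str mid.
have [cl cl0 Hl] := prior_mass_gt0 Tl Ts lts.
have [cr cr0 Hr] := prior_mass_gt0 Ts Tr str.
exists (Num.min cl cr); first by rewrite lt_min cl0.
move=> U n s mU UT sU.
set k := aff tl tr ts ^+ n * lik ts s.
have aff0 := @affinity_gt0 R eta A tl tr ts.
have k0 : 0 < k by rewrite mulr_gt0 ?exprn_gt0 ?likelihood_gt0.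
have k1 : k <= lik ts s.
  apply: ler_piMl; first by rewrite ltW ?likelihood_gt0.
  by apply: exprn_ile1; [exact: ltW|exact: (affinity_le1 p_density)].
have kprod : lik tl s * lik tr s = k ^+ 2 by exact: likelihood_midpoint.
have [kr|kr] := leP k (lik tr s).
- apply: (@le_trans _ _ (k%:E * \int[leb]_(theta in `[ts, tr]) (prior theta)%:E)%E).
    rewrite mulrC EFinM lee_wpmul2l ?lee_fin ?(ltW k0)//.
    by apply: le_trans Hr; rewrite lee_fin ge_min lexx orbT.
  apply: weight_lower => //.
  + apply: subset_trans sU => x /=; rewrite !in_itv/= => /andP[sx ->].
    by rewrite (le_trans (ltW lts)).
  + exact: ltW.
  move=> t /=; rewrite in_itv/= => /andP[st tt].
  have Tt : Theta t by apply: (iTheta Ts Tr); rewrite st.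
  apply: le_trans (likelihood_quasi_concave p_density s Ts Tr Tt
    (eta_le Ts Tt st) (eta_le Tt Tr tt)).
  by rewrite le_min k1.
- have kl : k <= lik tl s.
    rewrite leNgt; apply/negP => lk.
    have : lik tl s * lik tr s < k * k by rewrite ltr_pM// ?ltW ?likelihood_gt0.
    by rewrite kprod expr2 ltxx.
  apply: (@le_trans _ _ (k%:E * \int[leb]_(theta in `[tl, ts]) (prior theta)%:E)%E).
    rewrite mulrC EFinM lee_wpmul2l ?lee_fin ?(ltW k0)//.
    by apply: le_trans Hl; rewrite lee_fin ge_min lexx.
  apply: weight_lower => //.
  + apply: subset_trans sU => x /=; rewrite !in_itv/= => /andP[-> xs].
    by rewrite (le_trans xs)// ltW.
  + exact: ltW.
  move=> t /=; rewrite in_itv/= => /andP[tt ts'].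
  have Tt : Theta t by apply: (iTheta Tl Ts); rewrite tt.
  apply: le_trans (likelihood_quasi_concave p_density s Tl Ts Tt
    (eta_le Tl Tt tt) (eta_le Tt Ts ts')).
  by rewrite le_min k1 kl.
Qed.

(** Log-concavity again: a likelihood that has already dropped between [ts] and
    the endpoints of an interval around it stays below its endpoint values
    outside that interval. *)
Lemma weight_outside_upper tl ts tr n (s : n.-tuple T) k :
  Theta tl -> Theta ts -> Theta tr -> tl < ts -> ts < tr ->
  lik tl s <= k -> lik tr s <= k -> k < lik ts s ->
  (weight (Theta `\` `[tl, tr]) s <= k%:E)%E.
Proof.
move=> Tl Ts Tr lts str lk rk ks.
apply: weight_upper => //.
- exact: measurableD.
- by apply: le_trans lk; rewrite ltW// likelihood_gt0.
move=> t [Tt /=]; rewrite in_itv/= => /negP; rewrite negb_and -!ltNge => /orP[tl_|tr_].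
- have := likelihood_quasi_concave p_density s Tt Ts Tl
    (eta_le Tt Tl (ltW tl_)) (eta_le Tl Ts (ltW lts)).
  move=> /le_trans /(_ lk); rewrite ge_min => /orP[//|].
  by rewrite leNgt ks.
- have := likelihood_quasi_concave p_density s Ts Tt Tr
    (eta_le Ts Tr (ltW str)) (eta_le Tr Tt (ltW tr_)).
  move=> /le_trans /(_ rk); rewrite ge_min => /orP[|//].
  by rewrite leNgt ks.
Qed.

Lemma marginal_le_weight tl ts tr n (s : n.-tuple T) k e :
  Theta tl -> Theta ts -> Theta tr -> tl < ts -> ts < tr ->
  lik tl s <= k -> lik tr s <= k -> k < lik ts s -> 0 <= e ->
  (k%:E <= e%:E * weight `[tl, tr] s)%E ->
  (marginal p Theta prior s <= (1 + e)%:E * weight `[tl, tr] s)%E.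
Proof.
move=> Tl Ts Tr lts str lk rk ks e0 ke.
have sub : `[tl, tr]%classic `<=` Theta.
  by move=> x /=; rewrite in_itv/=; exact: iTheta.
rewrite (marginal_split s (measurable_itv _) sub).
have w0 : (0 <= weight `[tl, tr] s)%E.
  apply: integral_ge0 => x /sub Tx.
  by rewrite lee_fin mulr_ge0 ?prior_ge0// ltW ?likelihood_gt0.
rewrite EFinD ge0_muleDl ?lee_fin// mul1e leeD2l//.
apply: le_trans ke.
exact: weight_outside_upper ks.
Qed.

(** The density of [x] at a parameter between [tl] and [tr] is at least the
    smaller of its endpoint values, so it factors out of the integral. *)
Lemma marginal_cons_ge tl tr n (s : n.-tuple T) x :
  Theta tl -> Theta tr -> tl < tr ->
  ((Num.min (p tl x) (p tr x))%:E * weight `[tl, tr] s <=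
   marginal p Theta prior (cons_pair (x, s)))%E.
Proof.
move=> Tl Tr ltr.
have sub : `[tl, tr]%classic `<=` Theta.
  by move=> y /=; rewrite in_itv/=; exact: iTheta.
have min0 : 0 <= Num.min (p tl x) (p tr x) by rewrite le_min !expR_ge0.
have w0 t : Theta t -> 0 <= lik t s * prior t.
  by move=> Tt; rewrite mulr_ge0 ?prior_ge0// ltW ?likelihood_gt0.
have mw k (s' : k.-tuple T) : measurable_fun `[tl, tr]%classic
    (fun t => (lik t s' * prior t)%:E).
  by apply/measurable_EFinP; apply: measurable_funS (measurable_posterior_weight s').
apply: le_trans (weight_le_marginal _ (measurable_itv _) sub).
rewrite -ge0_integralZl_EFin//; last 2 first.
- by move=> t /sub Tt; rewrite lee_fin w0.
- exact: mw.
apply: ge0_le_integral => //.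
- by move=> t /sub Tt; rewrite -EFinM lee_fin mulr_ge0// w0.
- by apply: measurable_funeM; exact: mw.
- exact: mw.
- move=> t tlr; have Tt : Theta t by exact: sub.
  move: tlr; rewrite /= in_itv/= => /andP[ge_tl le_tr].
  rewrite likelihood_cons -EFinM lee_fin -[leRHS]mulrA ler_wpM2r ?w0//.
  exact: (density_quasi_concave p_density _ Tl Tr Tt
           (eta_le Tl Tt ge_tl) (eta_le Tt Tr le_tr)).
Qed.

(** * One more observation *)

Lemma marginal_gt0 n (s : n.-tuple T) : (0 < marginal p Theta prior s)%E.
Proof.
have [c c0 Hc] := prior_mass_gt0 Tta Ttb tab.
have sub : `[ta, tb]%classic `<=` Theta.
  by move=> x /=; rewrite in_itv/=; exact: iTheta.
pose k := Num.min (lik ta s) (lik tb s).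
have k0 : 0 < k by rewrite lt_min !likelihood_gt0.
have : ((k * c)%:E <= marginal p Theta prior s)%E.
  apply: le_trans (weight_lower (s := s) (measurable_itv _) mTheta sub
    (@subset_refl _ _) (ltW k0) _).
    by rewrite EFinM lee_wpmul2l// lee_fin ltW.
  move=> t tt; have Tt : Theta t by exact: sub.
  move: tt; rewrite /= in_itv/= => /andP[at_ le_tb].
  exact: (likelihood_quasi_concave p_density s Tta Ttb Tt
    (eta_le Tta Tt at_) (eta_le Tt Ttb le_tb)).
by apply: lt_le_trans; rewrite lte_fin mulr_gt0.
Qed.

(** The marginal is positive, so that its inverse is a real number; it is 0
    where the marginal is infinite. *)
Definition inv_marginal n (s : n.-tuple T) : R :=
  fine ((marginal p Theta prior s)^-1)%E.

Lemma inv_marginalE n (s : n.-tuple T) :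
  ((marginal p Theta prior s)^-1 = (inv_marginal s)%:E)%E.
Proof.
have m0 := marginal_gt0 s; rewrite /inv_marginal fineK// fin_numV ?(gt_eqF m0)//.
by rewrite gt_eqF// (lt_trans (ltNyr 0) m0).
Qed.

Lemma inv_marginal_ge0 n (s : n.-tuple T) : 0 <= inv_marginal s.
Proof. by rewrite -lee_fin -inv_marginalE inve_ge0 ltW// marginal_gt0. Qed.

Lemma inv_marginal_le n (s : n.-tuple T) k : 0 < k ->
  (k%:E <= marginal p Theta prior s)%E -> inv_marginal s <= k^-1.
Proof.
move=> k0 km; rewrite -lee_fin -inv_marginalE.
rewrite (_ : (k^-1)%:E = (k%:E)^-1%E); last by rewrite inver gt_eqF.
by rewrite lee_pV2// inE ?lee_fin ?ltW// marginal_gt0.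
Qed.

(** The case analysis is for infinite marginals: if the one of [s'] is infinite
    then the bound is trivial, and this holds if the one of [s] is infinite. *)
Lemma inv_marginal_le_scale n n' (s : n.-tuple T) (s' : n'.-tuple T) k : 0 < k ->
  (k%:E * marginal p Theta prior s <= marginal p Theta prior s')%E ->
  inv_marginal s' <= k^-1 * inv_marginal s.
Proof.
move=> k0; rewrite -lee_fin EFinM -!inv_marginalE.
have := marginal_gt0 s; have := marginal_gt0 s'.
case: (marginal _ _ _ s) => [m| |] //; last first.
  move=> _ _; rewrite gt0_muley ?lte_fin// leye_eq => /eqP ->.
  by rewrite invey mule0.
case: (marginal _ _ _ s') => [m'| |] //; last first.
  move=> _ m0 _; rewrite invey inver (gt_eqF (m0 : 0 < m)) -EFinM lee_fin.
  by rewrite mulr_ge0 ?invr_ge0 ?ltW.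
rewrite !lte_fin -EFinM lee_fin => m'0 m0 kmm'.
by rewrite !inver !gt_eqF// -EFinM lee_fin -invfM lef_pV2 ?posrE ?mulr_gt0.
Qed.

(** The inverse is less than [r > 0] exactly where the marginal exceeds
    [r^-1], infinite marginals included. *)
Lemma measurable_inv_marginal n : measurable_fun setT (@inv_marginal n).
Proof.
apply: (measurability _ (RGenInftyO.measurableE R)) => _ [_ [r ->] <-].
have [r0|r0] := ltP 0 r; last first.
  rewrite (_ : _ `&` _ = set0); first exact: measurable0.
  apply/seteqP; split=> // s [_ /=]; rewrite in_itv/= => h.
  by have := inv_marginal_ge0 s; rewrite leNgt (lt_le_trans h r0).
rewrite (_ : _ `&` _ = setT `&` [set s | ((r^-1)%:E < marginal p Theta prior s)%E]).
  by apply: emeasurable_fun_o_infty => //; exact: measurable_marginal.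
congr (_ `&` _); apply/seteqP; split=> s /=; rewrite in_itv/= -lte_fin -inv_marginalE.
all: rewrite (_ : (r^-1)%:E = (r%:E)^-1%E); last by rewrite inver gt_eqF.
all: by rewrite inve_plt ?inE ?lee_fin ?(ltW r0)// ltW// marginal_gt0.
Qed.

(** The density at [s], under the parameter [ts] itself, times the posterior
    density at [ts] divided by the prior density there. *)
Definition self_posterior ts n (s : n.-tuple T) : R := lik ts s ^+ 2 * inv_marginal s.

Lemma self_posterior_ge0 ts n (s : n.-tuple T) : 0 <= self_posterior ts s.
Proof. by rewrite mulr_ge0 ?exprn_ge0 ?inv_marginal_ge0// ltW ?likelihood_gt0. Qed.

Let measurable_lik t n : Theta t -> measurable_fun setT (@likelihood _ T R p t n).
Proof. by move=> /p_density[mp _ _]; exact: measurable_likelihood. Qed.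

Lemma measurable_self_posterior ts n : Theta ts ->
  measurable_fun setT (@self_posterior ts n).
Proof.
move=> Ts; apply: measurable_funM; last exact: measurable_inv_marginal.
by apply: measurable_funX; exact: measurable_lik.
Qed.

(** Since [p^2 / m + m >= 2 p] and both the likelihood [p] and the marginal [m]
    integrate to 1. *)
Lemma integral_self_posterior_ge1 ts n : Theta ts ->
  (1 <= \int[power_measure nu n]_s (self_posterior ts s)%:E)%E.
Proof.
move=> Ts.
have mself := @measurable_self_posterior ts n Ts.
have mlik := @measurable_lik ts n Ts.
rewrite -(@leeD2rE _ 1%E)//.
rewrite -[in leRHS](integral_marginal n) -ge0_integralD//; last 4 first.
- by move=> s _; rewrite lee_fin self_posterior_ge0.
- exact/measurable_EFinP.
- by move=> s _; exact/ltW/marginal_gt0.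
- exact: measurable_marginal.
rewrite -EFinD.
have lik2 : (2%:E = \int[power_measure nu n]_s (2 * lik ts s)%:E)%E.
  by rewrite integral_densityZ//; apply: likelihood_density; exact: p_density.
rewrite (_ : 1 + 1 = 2)// lik2; apply: ge0_le_integral => //.
- by move=> s _; rewrite lee_fin mulr_ge0// ltW ?likelihood_gt0.
- by apply/measurable_EFinP/measurable_funM.
- by apply: emeasurable_funD; [exact/measurable_EFinP|exact: measurable_marginal].
move=> s _; rewrite /self_posterior.
have := inv_marginalE s; have := marginal_gt0 s; have := inv_marginal_ge0 s.
case: (marginal _ _ _ s) => [m| |]//; last by move=> *; rewrite addey ?leey.
move=> w0; rewrite lte_fin => m0; rewrite inver gt_eqF// => -[<-].
rewrite -EFinD lee_fin -subr_ge0.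
rewrite (_ : _ - _ = (lik ts s - m) ^+ 2 / m); last by field; rewrite gt_eqF.
by rewrite divr_ge0 ?sqr_ge0 ?ltW.
Qed.

(** With [x = u ^+ 2], [y = v ^+ 2] and [z = u * v], this is
    [`|x - y| / 2 <= (u - v) ^+ 2 / (4 * t) + t * (u + v) ^+ 2 / 4], by the
    inequality of the means, with [(u + v) ^+ 2] bounded by [2 * (x + y)].
    For densities [x] and [y] the first square integrates to a quantity
    governed by the affinity, which bounds the integral of the maximum. *)
Lemma max_le_mean (x y z t : R) : 0 <= x -> 0 <= y -> 0 <= z -> x * y = z ^+ 2 ->
  0 < t ->
  Num.max x y + z / (2 * t) <= (1 / 2 + 1 / (4 * t) + t / 2) * (x + y).
Proof.
move=> + + z0; wlog xy : x y / y <= x.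
  move=> H x0 y0 xyz t0; have /orP[yx|xy] := le_total y x; first exact: H.
  by rewrite maxC (addrC x); apply: H => //; rewrite mulrC.
move=> x0 y0 xyz t0; rewrite max_l//.
pose u := Num.sqrt x; pose v := Num.sqrt y.
have xE : x = u ^+ 2 by rewrite sqr_sqrtr.
have yE : y = v ^+ 2 by rewrite sqr_sqrtr.
have zE : z = u * v.
  by rewrite /u /v -sqrtrM// xyz sqrtr_sqr ger0_norm.
rewrite -subr_ge0.
rewrite (_ : _ - _ = (((u - v) - t * (u + v)) ^+ 2 + (t * (u - v)) ^+ 2) / (4 * t)).
  by rewrite divr_ge0 ?addr_ge0 ?sqr_ge0// mulr_ge0// ltW.
by rewrite xE yE zE; field; rewrite gt_eqF.
Qed.

(** The interval [[tl, tr]] is where the posterior concentrates, and [hl], [hr]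
    are the midpoints between [ts] and its ends.  The rate [q < 1] measures how
    fast [tl] and [tr] are ruled out, while [k] is the rate of the universal
    lower bound for the marginal; it comes from a narrower pair of symmetric
    points and thus can be chosen greater than [q]. *)
Section Step.
Variables (tl ts tr hl hr : R).
Hypotheses (Tl : Theta tl) (Ts : Theta ts) (Tr : Theta tr).
Hypotheses (Thl : Theta hl) (Thr : Theta hr).
Hypotheses (lts : tl < ts) (str : ts < tr).
Hypothesis mid : eta tl + eta tr = 2 * eta ts.
Hypotheses (midl : eta ts + eta tl = 2 * eta hl)
           (midr : eta ts + eta tr = 2 * eta hr).
Variables (k c q e : R).
Hypotheses (k0 : 0 < k) (c0 : 0 < c) (q0 : 0 < q) (q1 : q < 1) (e0 : 0 < e).
Hypotheses (affl : aff ts tl hl <= q ^+ 2) (affr : aff ts tr hr <= q ^+ 2).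
Hypothesis weight_ge : forall n (s : n.-tuple T),
  ((c * (k ^+ n * lik ts s))%:E <= weight `[tl, tr] s)%E.

Let sub : `[tl, tr]%classic `<=` Theta.
Proof. by move=> x /=; rewrite in_itv/=; exact: iTheta. Qed.

(** The product of the likelihoods at [ts] and [t] is at most
    [(q ^+ 2) ^+ n * lik h s] squared: if the likelihood at [t] is large
    compared to the one at [ts], then the latter is small compared to the one
    at [h]. *)
Let drop_or_atypical t h n (s : n.-tuple T) : aff ts t h <= q ^+ 2 ->
  eta ts + eta t = 2 * eta h ->
  lik t s <= (q ^+ 2) ^+ n * lik ts s \/ lik ts s <= q ^+ n * lik h s.
Proof.
move=> a2 midh; have [|dr] := leP (lik t s) ((q ^+ 2) ^+ n * lik ts s); first by left.
right; have L0 := likelihood_gt0 eta A S B ts s.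
have H0 := likelihood_gt0 eta A S B h s.
have a0 := @affinity_gt0 R eta A ts t h.
have prod := likelihood_midpoint A S B s midh.
have qn0 : 0 < q ^+ n by rewrite exprn_gt0.
have key : (q ^+ n * lik ts s) ^+ 2 <= ((q ^+ 2) ^+ n * lik h s) ^+ 2.
  apply: (@le_trans _ _ (lik ts s * lik t s)).
    have -> : (q ^+ n * lik ts s) ^+ 2 = lik ts s * ((q ^+ 2) ^+ n * lik ts s).
      by rewrite exprMn -!exprM mulnC; ring.
    by rewrite ler_wpM2l ?ltW.
  have q2n0 : 0 < (q ^+ 2) ^+ n by rewrite !exprn_gt0.
  have an0 : 0 < aff ts t h ^+ n by rewrite exprn_gt0.
  have aq : aff ts t h ^+ n <= (q ^+ 2) ^+ n.
    by apply: lerXn2r; rewrite ?nnegrE ?sqr_ge0// ltW.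
  rewrite prod; apply: lerXn2r; rewrite ?nnegrE.
  - by rewrite mulr_ge0 ?ltW.
  - by rewrite mulr_ge0 ?ltW.
  - by rewrite ler_wpM2r// ltW.
have : q ^+ n * lik ts s <= q ^+ n * (q ^+ n * lik h s).
  rewrite -(@ler_pXn2r _ 2) ?nnegrE ?mulr_ge0 ?(ltW qn0) ?(ltW L0) ?(ltW H0)//.
  by apply: le_trans key _; rewrite mulrA -expr2 -!exprM mulnC.
by rewrite ler_pM2l.
Qed.

Lemma concentrated_or_atypical n (s : n.-tuple T) : (0 < n)%N ->
  (q ^+ 2) ^+ n <= e * (c * k ^+ n) ->
  (marginal p Theta prior s <= (1 + e)%:E * weight `[tl, tr] s)%E \/
  lik ts s <= q ^+ n * (lik hl s + lik hr s).
Proof.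
move=> n0 qe; have qn0 : 0 < q ^+ n by rewrite exprn_gt0.
have L0 t := likelihood_gt0 eta A S B t s.
case: (drop_or_atypical s affl midl) => [dl|al]; last first.
  by right; rewrite mulrDr (le_trans al)// lerDl mulr_ge0 ?ltW.
case: (drop_or_atypical s affr midr) => [dr|ar]; last first.
  by right; rewrite mulrDr (le_trans ar)// lerDr mulr_ge0 ?ltW.
have drop : (q ^+ 2) ^+ n * lik ts s < lik ts s.
  by rewrite gtr_pMl// -exprM exprn_ilt1 ?(ltW q0)// muln_eq0/= -lt0n.
left; apply: (marginal_le_weight Tl Ts Tr lts str dl dr drop (ltW e0)).
apply: le_trans (_ : e%:E * (c * (k ^+ n * lik ts s))%:E <= _)%E.
  by rewrite -EFinM lee_fin [c * _]mulrA mulrA ler_wpM2r// ltW.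
by rewrite lee_wpmul2l ?lee_fin// ltW.
Qed.

Local Notation D := (aff tl tr ts).

Let inv_marginal_bound n (s : n.-tuple T) :
  inv_marginal s <= (c * (k ^+ n * lik ts s))^-1.
Proof.
apply: inv_marginal_le.
  by rewrite !mulr_gt0 ?exprn_gt0 ?likelihood_gt0.
exact: le_trans (weight_ge s) (weight_le_marginal s (measurable_itv _) sub).
Qed.

Lemma self_posterior_le n (s : n.-tuple T) :
  self_posterior ts s <= (c * k ^+ n)^-1 * lik ts s.
Proof.
have L0 := likelihood_gt0 eta A S B ts s.
rewrite (_ : _^-1 * _ = lik ts s ^+ 2 * (c * (k ^+ n * lik ts s))^-1).
  by apply: ler_wpM2l; [exact: sqr_ge0|exact: inv_marginal_bound].
by field; rewrite !gt_eqF ?exprn_gt0.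
Qed.

(** The first term bounds the concentrated case: the marginal of the longer
    sample is at least [Num.min (p tl x) (p tr x) / (1 + e)] times the old one,
    and the product of that minimum and the maximum is [(D * p ts x) ^+ 2].  The
    second term bounds the atypical case. *)
Lemma self_posterior_step n (s : n.-tuple T) x : (0 < n)%N ->
  (q ^+ 2) ^+ n <= e * (c * k ^+ n) ->
  self_posterior ts (cons_pair (x, s)) <=
  (1 + e) / D ^+ 2 * self_posterior ts s * Num.max (p tl x) (p tr x) +
  q ^+ n / (c * k ^+ n.+1) * (lik hl s + lik hr s) * p ts x.
Proof.
move=> n0 qe.
have L0 t := likelihood_gt0 eta A S B t s.
have P0 t : 0 < p t x by exact: expR_gt0.
have D0 : 0 < D by exact: affinity_gt0.
have min0 : 0 < Num.min (p tl x) (p tr x) by rewrite lt_min !P0.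
have max0 : 0 <= Num.max (p tl x) (p tr x) by rewrite le_max (ltW (P0 _)).
have e1 : 0 < 1 + e by rewrite addr_gt0.
have A0 : 0 <= (1 + e) / D ^+ 2 * self_posterior ts s * Num.max (p tl x) (p tr x).
  apply: mulr_ge0 => //; apply: mulr_ge0; last exact: self_posterior_ge0.
  by apply: divr_ge0; [exact: ltW|exact: sqr_ge0].
have B0 : 0 <= q ^+ n / (c * k ^+ n.+1) * (lik hl s + lik hr s) * p ts x.
  rewrite ltW// mulr_gt0// mulr_gt0 ?addr_gt0//.
  by rewrite divr_gt0 ?mulr_gt0 ?exprn_gt0.
case: (concentrated_or_atypical s n0 qe) => [conc|atyp].
- apply: le_trans (_ : _ <= (1 + e) / D ^+ 2 * self_posterior ts s *
    Num.max (p tl x) (p tr x)) _; last by rewrite lerDl.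
  have mm : ((Num.min (p tl x) (p tr x) / (1 + e))%:E * marginal p Theta prior s <=
      marginal p Theta prior (cons_pair (x, s)))%E.
    apply: le_trans (marginal_cons_ge s x Tl Tr (lt_trans lts str)).
    apply: le_trans (lee_wpmul2l _ conc) _.
      by rewrite lee_fin divr_ge0 ?ltW.
    by rewrite muleA -EFinM divfK ?gt_eqF.
  have w' := inv_marginal_le_scale (divr_gt0 min0 e1) mm.
  rewrite {1}/self_posterior likelihood_cons.
  apply: le_trans (ler_wpM2l (sqr_ge0 _) w') _.
  have pp : p ts x ^+ 2 = Num.min (p tl x) (p tr x) * Num.max (p tl x) (p tr x) / D ^+ 2.
    have -> : Num.min (p tl x) (p tr x) * Num.max (p tl x) (p tr x) = p tl x * p tr x.
      by case: leP => // _; rewrite mulrC.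
    by rewrite (density_midpoint A S B x mid) exprMn mulrC mulKf// sqrf_eq0 gt_eqF.
  rewrite exprMn pp /self_posterior le_eqVlt; apply/orP; left; apply/eqP.
  by field; rewrite !gt_eqF.
- apply: le_trans (_ : _ <= q ^+ n / (c * k ^+ n.+1) *
    (lik hl s + lik hr s) * p ts x) _; last by rewrite lerDr.
  apply: le_trans (self_posterior_le _) _.
  rewrite likelihood_cons (mulrC (p ts x)) mulrA ler_wpM2r ?(ltW (P0 _))//.
  rewrite [q ^+ n / _]mulrC -mulrA ler_wpM2l// invr_ge0 ltW//.
  by rewrite mulr_gt0 ?exprn_gt0.
Qed.

Let measurable_p t : Theta t -> measurable_fun setT (p t).
Proof. by case/p_density. Qed.

Lemma integral_max_density_le t : 0 < t ->
  (\int[nu]_x (Num.max (p tl x) (p tr x))%:E <=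
   (1 + (1 - D) / (2 * t) + t)%:E)%E.
Proof.
move=> t0; have D0 : 0 <= D by exact/ltW/affinity_gt0.
have d0 : 0 <= D / (2 * t) by rewrite divr_ge0// mulr_ge0// ltW.
have P0 u x : 0 <= p u x by exact: expR_ge0.
pose al := 1 / 2 + 1 / (4 * t) + t / 2.
have al0 : 0 <= al.
  by rewrite /al !addr_ge0// divr_ge0// ?mulr_ge0// ltW.
have mmax : measurable_fun setT (fun x => Num.max (p tl x) (p tr x)).
  by apply: measurable_maxr; exact: measurable_p.
have -> : 1 + (1 - D) / (2 * t) + t = al + al - D / (2 * t).
  by rewrite /al; field; rewrite gt_eqF.
rewrite EFinB leeBrDr//.
rewrite -[in leLHS](integral_densityZ measurableT (p_density Ts) d0).
rewrite -ge0_integralD//; last 4 first.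
- by move=> x _; rewrite lee_fin le_max P0.
- exact/measurable_EFinP.
- by move=> x _; rewrite lee_fin mulr_ge0.
- by apply/measurable_EFinP/measurable_funM => //; exact: measurable_p.
have -> : (al + al)%:E = (\int[nu]_x (al * p tl x + al * p tr x)%:E)%E.
  rewrite EFinD -{1}(integral_densityZ measurableT (p_density Tl) al0).
  rewrite -(integral_densityZ measurableT (p_density Tr) al0) -ge0_integralD//.
  - by move=> x _; rewrite lee_fin mulr_ge0.
  - by apply/measurable_EFinP/measurable_funM => //; exact: measurable_p.
  - by move=> x _; rewrite lee_fin mulr_ge0.
  - by apply/measurable_EFinP/measurable_funM => //; exact: measurable_p.
apply: ge0_le_integral => //.
- move=> x _; rewrite -EFinD lee_fin.
  by apply: addr_ge0; [rewrite le_max P0|exact: mulr_ge0].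
- apply: emeasurable_funD; first exact/measurable_EFinP.
  by apply/measurable_EFinP/measurable_funM => //; exact: measurable_p.
- apply/measurable_EFinP.
  by apply: measurable_funD; apply: measurable_funM => //; exact: measurable_p.
move=> x _; rewrite -EFinD lee_fin -mulrDr.
have := @max_le_mean (p tl x) (p tr x) (D * p ts x) t (P0 _ _) (P0 _ _)
  (mulr_ge0 D0 (P0 _ _)) (density_midpoint A S B x mid) t0.
by rewrite -/al mulrAC.
Qed.

Lemma integral_self_posterior_lty n :
  (\int[power_measure nu n]_s (self_posterior ts s)%:E < +oo)%E.
Proof.
have ck0 : 0 < (c * k ^+ n)^-1 by rewrite invr_gt0 mulr_gt0 ?exprn_gt0.
apply: le_lt_trans (ltry ((c * k ^+ n)^-1)).
rewrite -(integral_densityZ measurableT (likelihood_density n (p_density Ts)) (ltW ck0)).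
apply: ge0_le_integral => //.
- by move=> s _; rewrite lee_fin self_posterior_ge0.
- by apply/measurable_EFinP; exact: measurable_self_posterior.
- by apply/measurable_EFinP/measurable_funM => //; exact: measurable_lik.
- by move=> s _; rewrite lee_fin self_posterior_le.
Qed.

Lemma integral_self_posterior_step n M : (0 < n)%N ->
  (q ^+ 2) ^+ n <= e * (c * k ^+ n) ->
  0 <= M -> (\int[nu]_x (Num.max (p tl x) (p tr x))%:E <= M%:E)%E ->
  (\int[power_measure nu n.+1]_s (self_posterior ts s)%:E <=
   ((1 + e) / D ^+ 2 * M)%:E * \int[power_measure nu n]_s (self_posterior ts s)%:E
   + (q ^+ n / (c * k ^+ n.+1) * 2)%:E)%E.
Proof.
move=> n0 qe M0 maxM.
have D0 : 0 < D by exact: affinity_gt0.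
have P0 u x : 0 <= p u x by exact: expR_ge0.
have L0 t (s : n.-tuple T) : 0 <= lik t s by exact/ltW/likelihood_gt0.
have e1 : 0 <= 1 + e by rewrite addr_ge0// ltW.
have a0 : 0 <= (1 + e) / D ^+ 2 by rewrite divr_ge0 ?sqr_ge0.
have b0 : 0 <= q ^+ n / (c * k ^+ n.+1).
  by rewrite divr_ge0 ?mulr_ge0 ?exprn_ge0 ?ltW.
have mmax : measurable_fun setT (fun x => Num.max (p tl x) (p tr x)).
  by apply: measurable_maxr; exact: measurable_p.
set a := (1 + e) / D ^+ 2 in a0 *; set b := q ^+ n / _ in b0 *.
have mself m : measurable_fun setT (@self_posterior ts m).
  exact: measurable_self_posterior.
have mlik t : Theta t -> measurable_fun setT (@likelihood _ T R p t n).
  exact: measurable_lik.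
have mcons : measurable_fun setT
    (fun z : T * n.-tuple T => self_posterior ts (cons_pair z)).
  exact: (measurableT_comp (mself n.+1) (@measurable_cons_pair _ T n)).
rewrite integral_power_measureS; last 2 first.
- by apply/measurable_EFinP; exact: mself.
- by move=> s; rewrite lee_fin self_posterior_ge0.
have inner (s : n.-tuple T) :
    (\int[nu]_x (self_posterior ts (cons_pair (x, s)))%:E <=
     (a * M * self_posterior ts s)%:E + (b * (lik hl s + lik hr s))%:E)%E.
  have g0 := self_posterior_ge0 ts s.
  have u0 : 0 <= a * self_posterior ts s by rewrite mulr_ge0.
  have v0 : 0 <= b * (lik hl s + lik hr s) by rewrite mulr_ge0 ?addr_ge0.
  apply: (@le_trans _ _ (\int[nu]_x
      ((a * self_posterior ts s)%:E * (Num.max (p tl x) (p tr x))%:E +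
       (b * (lik hl s + lik hr s) * p ts x)%:E))%E).
    apply: ge0_le_integral => //.
    - by move=> x _; rewrite lee_fin self_posterior_ge0.
    - by apply/measurable_EFinP; exact: (measurableT_comp mcons (measurable_pair2 s)).
    - apply: emeasurable_funD.
        by apply: measurable_funeM; exact/measurable_EFinP.
      by apply/measurable_EFinP/measurable_funM => //; exact: measurable_p.
    - by move=> x _; rewrite -EFinM -EFinD lee_fin; exact: self_posterior_step.
  rewrite ge0_integralD//; last 4 first.
  - by move=> x _; rewrite -EFinM lee_fin mulr_ge0// le_max P0.
  - by apply: measurable_funeM; exact/measurable_EFinP.
  - by move=> x _; rewrite lee_fin mulr_ge0.
  - by apply/measurable_EFinP/measurable_funM => //; exact: measurable_p.
  apply: leeD.
    rewrite ge0_integralZl_EFin//; last 2 first.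
    - by move=> x _; rewrite lee_fin le_max P0.
    - exact/measurable_EFinP.
    by rewrite [a * M * _]mulrAC [leRHS]EFinM lee_wpmul2l.
  by rewrite integral_densityZ//; exact: p_density.
apply: (@le_trans _ _ (\int[power_measure nu n]_s
    ((a * M * self_posterior ts s)%:E + (b * (lik hl s + lik hr s))%:E))%E).
  apply: ge0_le_integral => //.
  - by move=> s _; apply: integral_ge0 => x _; rewrite lee_fin self_posterior_ge0.
  - apply: (measurable_fun_fubini_tonelli_G
      (fun z : T * n.-tuple T => (self_posterior ts (cons_pair z))%:E)).
      by apply/measurable_EFinP; exact: mcons.
    by move=> z; rewrite lee_fin self_posterior_ge0.
  - apply: emeasurable_funD; apply/measurable_EFinP; apply: measurable_funM => //.
      exact: mself.
    by apply: measurable_funD; exact: mlik.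
rewrite ge0_integralD//; last 4 first.
- move=> s _; rewrite lee_fin mulr_ge0 ?self_posterior_ge0//.
  exact: mulr_ge0.
- by apply/measurable_EFinP/measurable_funM => //; exact: mself.
- by move=> s _; rewrite lee_fin mulr_ge0 ?addr_ge0.
- by apply/measurable_EFinP/measurable_funM => //; apply: measurable_funD; exact: mlik.
have aM0 : 0 <= a * M by exact: mulr_ge0.
apply: leeD.
  under eq_integral do rewrite EFinM.
  rewrite ge0_integralZl_EFin//.
  - by move=> s _; rewrite lee_fin self_posterior_ge0.
  - by apply/measurable_EFinP; exact: mself.
under eq_integral do rewrite mulrDr EFinD.
rewrite ge0_integralD//.
- rewrite !integral_densityZ//; try by apply: likelihood_density; exact: p_density.
  by rewrite -EFinD lee_fin mulr_natr mulr2n.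
- by move=> s _; rewrite lee_fin mulr_ge0.
- by apply/measurable_EFinP/measurable_funM => //; exact: mlik.
- by move=> s _; rewrite lee_fin mulr_ge0.
- by apply/measurable_EFinP/measurable_funM => //; exact: mlik.
Qed.

End Step.

(** * Growth of the expected posterior at the true parameter *)

Hypothesis A''_gt0 : forall theta, Theta theta ->
  0 < derive_within (eta @` Theta) (derive_within (eta @` Theta) A) (eta theta).

(** Symmetric points in the natural parameter, close enough to [ts] for their
    affinity to be close to 1; by convexity the deficit of the affinity is at
    most linear in their distance. *)
Lemma symmetric_pair lo ts hi k0 : Theta lo -> Theta ts -> Theta hi ->
  lo < ts -> ts < hi -> k0 < 1 -> exists tl tr, [/\ Theta tl /\ Theta tr,
  lo <= tl /\ tr <= hi, tl < ts /\ ts < tr, eta tl + eta tr = 2 * eta ts &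
  k0 < aff tl tr ts].
Proof.
move=> Tlo Ts Thi lots tshi k01.
have ell := eta_lt Tlo Ts lots; have elh := eta_lt Ts Thi tshi.
pose r := Num.min (eta hi - eta ts) (eta ts - eta lo).
have r0 : 0 < r by rewrite lt_min !subr_gt0 ell elh.
have rhi : r <= eta hi - eta ts by rewrite ge_min lexx.
have rlo : r <= eta ts - eta lo by rewrite ge_min lexx orbT.
have interp v : eta lo <= v <= eta hi -> exists2 t, Theta t & eta t = v.
  exact: continuous_incr_interp.
(* The points at distance r, which both exist in Theta, are the reference for
   convexity; those sought are at the fraction l of this distance. *)
have [sl Tsl slE] : exists2 t, Theta t & eta t = eta ts - r.
  by apply: interp; apply/andP; split; lra.
have [sr Tsr srE] : exists2 t, Theta t & eta t = eta ts + r.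
  by apply: interp; apply/andP; split; lra.
pose phi := A (eta sl) + A (eta sr) - 2 * A (eta ts).
pose l := Num.min 1 ((1 - k0) / (`|phi| + 1)).
have phi1 : 0 < `|phi| + 1 by rewrite ltr_wpDl.
have l0 : 0 < l by rewrite lt_min ltr01 divr_gt0// subr_gt0.
have l1 : l <= 1 by rewrite ge_min lexx.
have lphi : l * phi <= 1 - k0.
  apply: (@le_trans _ _ (l * (`|phi| + 1))).
    by rewrite ler_wpM2l ?(ltW l0)// (le_trans (ler_norm _))// lerDl.
  by rewrite -ler_pdivlMr// ge_min lexx orbT.
have lr : l * r <= r by rewrite ler_piMl// ltW.
have lr0 : 0 < l * r by rewrite mulr_gt0.
have [tl Ttl tlE] : exists2 t, Theta t & eta t = eta ts - l * r.
  by apply: interp; apply/andP; split; lra.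
have [tr Ttr trE] : exists2 t, Theta t & eta t = eta ts + l * r.
  by apply: interp; apply/andP; split; lra.
exists tl, tr; split=> //.
- split; rewrite leNgt; apply/negP => /eta_lt.
    by move=> /(_ Ttl Tlo); rewrite tlE; lra.
  by move=> /(_ Thi Ttr); rewrite trE; lra.
- by split; apply: eta_lt_inv => //; rewrite ?tlE ?trE; lra.
- by rewrite tlE trE; ring.
- have cl : A (eta tl) <= l * A (eta sl) + (1 - l) * A (eta ts).
    apply: (log_partition_convex p_density Tsl Ts Ttl (ltW l0) l1).
    by rewrite tlE slE; ring.
  have cr : A (eta tr) <= l * A (eta sr) + (1 - l) * A (eta ts).
    apply: (log_partition_convex p_density Tsr Ts Ttr (ltW l0) l1).
    by rewrite trE srE; ring.
  have := expR_ge1Dx (A (eta ts) - (A (eta tl) + A (eta tr)) / 2).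
  apply: lt_le_trans; move: lphi; rewrite /phi => lphi; lra.
Qed.

Section Growth.
Variables (lo ts hi : R).
Hypotheses (Tlo : Theta lo) (Ts : Theta ts) (Thi : Theta hi).
Hypotheses (lots : lo < ts) (tshi : ts < hi).

Local Notation E n := (\int[power_measure nu n]_s (self_posterior ts s)%:E)%E.

Lemma expected_self_posterior_lty n : (E n < +oo)%E.
Proof.
have [tl [tr [[Tl Tr] _ [lts str] mid k0]]] :=
  symmetric_pair Tlo Ts Thi lots tshi (ltr01 : (0 : R) < 1).
have [c c0 Hc] := weight_lower_symmetric Tl Ts Tr lts str mid.
have wge m (s : m.-tuple T) :
    ((c * (aff tl tr ts ^+ m * lik ts s))%:E <= weight `[tl, tr] s)%E.
  by apply: Hc => // x /=; rewrite in_itv/=; exact: iTheta.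
exact: (integral_self_posterior_lty Tl Ts Tr k0 c0 wge).
Qed.

(** The choice of constants behind [integral_self_posterior_step]: first the
    interval [[tl, tr]], narrow enough for a growth factor at most
    [1 + eps / 2]; this determines [q]; then the inner pair with [k > q], which
    makes the additive error, of order [(q / k) ^+ n], vanish. *)
Theorem expected_self_posterior_growth eps : 0 < eps ->
  exists N, forall n, (N <= n)%N -> (E n.+1 <= (1 + eps)%:E * E n)%E.
Proof.
move=> eps0; pose x := Num.min 1 (eps / 22).
have x0 : 0 < x by rewrite lt_min ltr01 divr_gt0.
have x1 : x <= 1 by rewrite ge_min lexx.
have xeps : 11 * x <= eps / 2.
  have : x <= eps / 22 by rewrite ge_min lexx orbT.
  by move=> h; lra.
(* With affinity D > 1 - x ^+ 2 / 4, the growth factor proves to be at most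
   (1 + x) * (1 + x) * (1 + 2 * x) <= 1 + 11 * x, for x <= 1. *)
have x4 : 1 - x ^+ 2 / 4 < 1 :> R by rewrite gtrBl divr_gt0// exprn_gt0.
have [tl [tr [[Tl Tr] _ [lts str] mid]]] :=
  symmetric_pair Tlo Ts Thi lots tshi x4.
set D := aff tl tr ts; rewrite expr2 => Dx.
have D1 : D <= 1 by exact: (affinity_le1 p_density).
have D0 : 0 < D by exact: affinity_gt0.
have interp v : eta tl <= v <= eta tr -> exists2 t, Theta t & eta t = v.
  exact: continuous_incr_interp.
have els := eta_lt Tl Ts lts; have esr := eta_lt Ts Tr str.
have [hl Thl hlE] : exists2 t, Theta t & eta t = (eta ts + eta tl) / 2.
  by apply: interp; apply/andP; split; lra.
have [hr Thr hrE] : exists2 t, Theta t & eta t = (eta ts + eta tr) / 2.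
  by apply: interp; apply/andP; split; lra.
have midl : eta ts + eta tl = 2 * eta hl by rewrite hlE; field.
have midr : eta ts + eta tr = 2 * eta hr by rewrite hrE; field.
pose q2 := Num.max (aff ts tl hl) (aff ts tr hr).
have q20 : 0 < q2 by rewrite lt_max affinity_gt0.
have q21 : q2 < 1.
  rewrite gt_max !(affinity_lt1 p_density iTheta eta_cont eta_incr A''_gt0)//.
    by rewrite lt_eqF.
  by rewrite gt_eqF.
pose q := Num.sqrt q2.
have q0 : 0 < q by rewrite sqrtr_gt0.
have qq : q ^+ 2 = q2 by rewrite sqr_sqrtr// ltW.
have q1 : q < 1 by rewrite -sqrtr1 ltr_sqrt.
have affl : aff ts tl hl <= q ^+ 2 by rewrite qq le_max lexx.
have affr : aff ts tr hr <= q ^+ 2 by rewrite qq le_max lexx orbT.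
(* The inner pair, whose only role is to make the lower bound for the marginal
   decay at a rate k slower than q. *)
have [il [ir [[Til Tir] [tlil irtr] [ils sir] imid]]] :=
  symmetric_pair Tl Ts Tr lts str q1.
set k := aff il ir ts => qk.
have k0 : 0 < k by exact: affinity_gt0.
have [c c0 Hc] := weight_lower_symmetric Til Ts Tir ils sir imid.
have wge m (s : m.-tuple T) :
    ((c * (k ^+ m * lik ts s))%:E <= weight `[tl, tr] s)%E.
  apply: Hc => //.
    by move=> y /=; rewrite in_itv/=; exact: iTheta.
  move=> y /=; rewrite !in_itv/= => /andP[ily yir].
  by rewrite (le_trans tlil)// (le_trans yir).
have z1 : `|q / k| < 1.
  by rewrite gtr0_norm ?divr_gt0// ltr_pdivrMr// mul1r.
pose b := Num.min (x * c) (eps * (c * k) / 4).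
have b0 : 0 < b by rewrite lt_min !(mulr_gt0, divr_gt0).
have [N _ HN] : \forall n \near \oo, (q / k) ^+ n <= b.
  have /cvgr0Pnorm_le /(_ _ b0) := cvg_expr z1.
  by apply: filterS => n; apply: le_trans; exact: ler_norm.
exists N.+1 => n Nn; have n0 : (0 < n)%N by exact: leq_trans Nn.
have kn0 : 0 < k ^+ n by rewrite exprn_gt0.
have := HN n (ltnW Nn); rewrite /= expr_div_n ler_pdivrMr// => qn.
have qn1 : (q ^+ 2) ^+ n <= x * (c * k ^+ n).
  apply: (@le_trans _ _ (q ^+ n)).
    by rewrite -exprM mulnC exprM expr2 ler_piMl ?exprn_ge0 ?exprn_ile1 ?ltW.
  by apply: le_trans qn _; rewrite mulrA ler_wpM2r ?(ltW kn0)// ge_min lexx.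
have qn2 : q ^+ n / (c * k ^+ n.+1) * 2 <= eps / 2.
  have : q ^+ n <= eps * (c * k) / 4 * k ^+ n.
    by apply: le_trans qn _; rewrite ler_wpM2r ?(ltW kn0)// ge_min lexx orbT.
  move=> qn2; rewrite mulrAC ler_pdivrMr ?mulr_gt0 ?exprn_gt0//.
  rewrite exprS; lra.
have step := integral_self_posterior_step Tl Ts Tr Thl Thr lts str mid midl midr
  k0 c0 q0 q1 x0 affl affr wge n0 qn1 _ (integral_max_density_le Tl Ts Tr mid x0).
have M0 : 0 <= 1 + (1 - D) / (2 * x) + x.
  by rewrite !addr_ge0// ?(ltW x0)// divr_ge0 ?subr_ge0// mulr_ge0// ltW.
apply: le_trans (step M0) _.
have E1 := integral_self_posterior_ge1 n Ts.
have xx : x * x <= x by rewrite ler_piMl// ltW.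
have K : (1 + x) / D ^+ 2 * (1 + (1 - D) / (2 * x) + x) <= 1 + eps / 2.
  have Dinv : (D ^+ 2)^-1 <= 1 + x.
    rewrite -[leLHS]mul1r ler_pdivrMr ?exprn_gt0//.
    have D2 : 1 - x / 2 <= D ^+ 2.
      have Dx' : 1 - x / 4 <= D by lra.
      have x40 : 0 <= 1 - x / 4 by lra.
      have := ler_pM x40 x40 Dx' Dx'; rewrite -[D * D]expr2; nra.
    have := ler_wpM2l (_ : 0 <= 1 + x) D2; rewrite addr_ge0// ?(ltW x0)// => /(_ isT).
    lra.
  have M1 : 1 + (1 - D) / (2 * x) + x <= 1 + 2 * x.
    have : (1 - D) / (2 * x) <= x by rewrite ler_pdivrMr ?mulr_gt0//; nra.
    lra.
  apply: (@le_trans _ _ ((1 + x) * (1 + x) * (1 + 2 * x))).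
    apply: ler_pM => //.
      by rewrite divr_ge0 ?exprn_ge0 ?addr_ge0 ?ltW.
    by rewrite ler_wpM2l// addr_ge0// ltW.
  nra.
(* The additive error is absorbed because E n >= 1. *)
apply: (@le_trans _ _ ((1 + eps / 2)%:E * E n + (eps / 2)%:E * E n)%E).
  apply: leeD.
    by rewrite lee_wpmul2r ?lee_fin// (le_trans _ E1).
  apply: (@le_trans _ _ (eps / 2)%:E); first by rewrite lee_fin.
  by rewrite lee_pemulr// lee_fin divr_ge0// ltW.
rewrite -ge0_muleDl ?lee_fin ?addr_ge0 ?divr_ge0 ?(ltW eps0)//.
by rewrite -EFinD -addrA -splitr.
Qed.

End Growth.

Lemma expected_posteriorE theta0 theta1 ts n :
  Theta theta0 -> Theta ts -> eta theta0 + eta theta1 = 2 * eta ts ->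
  expected_posterior p Theta prior nu theta0 theta1 n =
  ((prior theta0 * (aff theta0 theta1 ts ^+ 2) ^+ n)%:E *
   \int[power_measure nu n]_s (self_posterior ts s)%:E)%E.
Proof.
move=> T0 Ts mid; rewrite -ge0_integralZl_EFin//.
- apply: eq_integral => s _; rewrite /posterior inv_marginalE -!EFinM.
  congr EFin; rewrite /self_posterior -exprM mulnC exprM.
  transitivity (prior theta0 * (lik theta0 s * lik theta1 s) * inv_marginal s).
    by ring.
  by rewrite (likelihood_midpoint A S B s mid); ring.
- by move=> s _; rewrite lee_fin self_posterior_ge0.
- by apply/measurable_EFinP; exact: measurable_self_posterior.
- by rewrite mulr_ge0 ?prior_ge0// !exprn_ge0// ltW// affinity_gt0.
Qed.

End Marginal.

(** * The eventual strict decrease *)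

Theorem corollary3 (R : realType) (X : set R) (X0 : X !=set0)
    (nu : {sigma_finite_measure set (borel_subspace X0) -> \bar R})
    (Theta : set R) (prior : R -> R)
    (eta A : R -> R) (T B : borel_subspace X0 -> R)
    (convex_Theta : convex_set (Theta : set (convex_lmodType R^o)))
    (prior_density : is_density lebesgue_measure Theta prior)
    (prior_continuous : {within Theta, continuous prior})
    (prior_gt0 : forall theta, Theta theta -> 0 < prior theta)
    (p_density : forall theta, Theta theta ->
       is_density nu [set: borel_subspace X0] (expfam eta A T B theta))
    (eta_derivable : forall theta, Theta theta ->
       derivable_within Theta eta theta)
    (eta'_gt0 : forall theta, Theta theta -> 0 < derive_within Theta eta theta)
    (A''_gt0 : forall theta, Theta theta ->
       0 < derive_within (eta @` Theta) (derive_within (eta @` Theta) A)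
             (eta theta))
    (theta0 theta1 : R) :
  Theta theta0 -> Theta theta1 -> theta1 != theta0 ->
  exists N : nat, forall n : nat, (N <= n)%N ->
    (expected_posterior (expfam eta A T B) Theta prior nu theta0 theta1 n.+1 <
     expected_posterior (expfam eta A T B) Theta prior nu theta0 theta1 n)%E.
Proof.
move=> T0 T1 ne.
have iT := convex_set_is_interval convex_Theta.
have ceta := derivable_within_continuous eta_derivable.
have incr := derive_within_gt0_incr iT eta_derivable eta'_gt0.
have [lo [hi [Tlo Thi lohi lohiE]]] : exists lo hi, [/\ Theta lo, Theta hi, lo < hi &
    eta theta0 + eta theta1 = eta lo + eta hi].
  have [lt|lt|e01] := ltgtP theta0 theta1.
  - by exists theta0, theta1.
  - by exists theta1, theta0; split=> //; rewrite addrC.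
  - by rewrite e01 eqxx in ne.
have elohi : eta lo < eta hi by apply: incr; rewrite ?inE.
have [ts Ts tsE] : exists2 t, Theta t & eta t = (eta lo + eta hi) / 2.
  apply: (continuous_incr_interp iT ceta incr Tlo Thi).
  by apply/andP; split; lra.
have mid : eta theta0 + eta theta1 = 2 * eta ts by rewrite lohiE tsE; field.
have lots : lo < ts by apply: (eta_lt_inv incr Tlo Ts); rewrite tsE; lra.
have tshi : ts < hi by apply: (eta_lt_inv incr Ts Thi); rewrite tsE; lra.
have r1 := affinity_lt1 p_density iT ceta incr A''_gt0 T0 T1 Ts _ mid.
have {r1} : affinity eta A theta0 theta1 ts < 1 by apply: r1; rewrite eq_sym.
have r0 := affinity_gt0 eta A theta0 theta1 ts.
pose r := affinity eta A theta0 theta1 ts ^+ 2.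
rewrite -(expr_lt1 (n := 2))// ?(ltW r0)// -/r => r1.
have {}r0 : 0 < r by rewrite exprn_gt0.
(* With eps = (1 - r) / 2, the factor r * (1 + eps) is less than 1. *)
have eps0 : 0 < (1 - r) / 2 by rewrite divr_gt0// subr_gt0.
have [N HN] := expected_self_posterior_growth p_density prior_density iT ceta incr
  Tlo Thi lohi prior_gt0 A''_gt0 Tlo Ts Thi lots tshi eps0.
exists N => n /HN.
rewrite !(expected_posteriorE p_density prior_density iT ceta incr Tlo Thi lohi
  prior_gt0 _ T0 Ts mid) -/r.
have := integral_self_posterior_ge1 p_density prior_density iT ceta incr
  Tlo Thi lohi prior_gt0 n Ts.
have := expected_self_posterior_lty p_density prior_density iT ceta incr
  Tlo Thi lohi prior_gt0 Tlo Ts Thi lots tshi n.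
case: (\int[power_measure nu n]_s _)%E => [E| |]// _; rewrite lee_fin => E1.
have c0 : 0 < prior theta0 * r ^+ n.
  by apply: mulr_gt0; [exact: prior_gt0|exact: exprn_gt0].
have c1 : 0 < prior theta0 * r ^+ n.+1.
  by apply: mulr_gt0; [exact: prior_gt0|exact: exprn_gt0].
move=> /(lee_wpmul2l (_ : 0 <= (prior theta0 * r ^+ n.+1)%:E)%E).
rewrite lee_fin => /(_ (ltW c1)) /le_lt_trans; apply.
rewrite -!EFinM lte_fin exprS.
rewrite (_ : _ * _ * _ =
  prior theta0 * r ^+ n * (r * (1 + (1 - r) / 2) * E)); last by ring.
rewrite ltr_pM2l// gtr_pMl ?(lt_le_trans ltr01)//.
nra.
Qed.
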